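(* For all $p\in\mathbb{N}$ and $\gamma>0$ the quantity $\mu(p,\gamma)$ is finite. Equivalently, $\lim_{N\to\infty}C_N\,r(p,\gamma)^N>0$.
   Context: Setting. Let $R,\ell>0$, $p\in\mathbb{N}$ and $\gamma=\ell/R$. $\mathcal{Z}=\mathbb{R}\times[0,2\pi R]$, with $z=x+iy$. Laughlin's function. $$\Psi_N(z_1,\ldots,z_N)=\kappa_N\prod_{1\le j<k\le N}\bigl(e^{z_k/R}-e^{z_j/R}\bigr)^p\exp\Bigl(-\frac{1}{2\ell^2}\sum_k x_k^2\Bigr),$$ with the specific normalization $$\kappa_N=\frac{1}{\sqrt{N!}}\,\bigl(2\pi R\ell\sqrt\pi\bigr)^{-N/2}\exp\Bigl(-\tfrac12p^2\gamma^2\sum_{j=1}^N(j-1)^2\Bigr).$$ Normalization constants. $C_N=\|\Psi_N\|^2=\int_{\mathcal{Z}^N}|\Psi_N|^2$. Known facts (from earlier work). The limits $$\lim_{N\to\infty}\frac1N\ln C_N=:-\log r(p,\gamma)\qquad\text{and}\qquad \lim_{N\to\infty}C_N\,r(p,\gamma)^N=:\mu(p,\gamma)^{-1}$$ exist, with $0<r(p,\gamma)\le1$ and $0<\mu(p,\gamma)\le\infty$. *)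

(* Defs.v *)
From HB Require Import structures.
From mathcomp Require Import all_boot all_order all_algebra.
From mathcomp Require Import all_classical all_reals all_analysis.
Set Implicit Arguments. Unset Strict Implicit. Unset Printing Implicit Defensive.
Import Order.TTheory GRing.Theory Num.Theory.
Local Open Scope classical_set_scope.
Local Open Scope ring_scope.

(* A point z = x + i y of the cylinder Z = R x [0, 2 pi Rc] is the pair (x, y). *)

(* Real and imaginary parts of e^{z/Rc} = e^{x/Rc} (cos(y/Rc) + i sin(y/Rc)). *)
Definition cexp_re {R : realType} (Rc : R) (z : R * R) : R :=
  expR (z.1 / Rc) * cos (z.2 / Rc).
Definition cexp_im {R : realType} (Rc : R) (z : R * R) : R :=
  expR (z.1 / Rc) * sin (z.2 / Rc).

Definition cexp_sqdist {R : realType} (Rc : R) (z w : R * R) : R :=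
  (cexp_re Rc z - cexp_re Rc w) ^+ 2 + (cexp_im Rc z - cexp_im Rc w) ^+ 2.

Definition gam {R : realType} (Rc l : R) : R := l / Rc.

Definition kappa {R : realType} (Rc l : R) (p N : nat) : R :=
  (Num.sqrt (N`!)%:R)^-1
  * (2 * pi * Rc * l * Num.sqrt pi) `^ (- (N%:R / 2))
  * expR (- (1/2) * ((p%:R) ^+ 2 * (gam Rc l) ^+ 2
                     * \sum_(1 <= j < N.+1) ((j - 1)%N%:R) ^+ 2)).

(* |Psi_N(z_1, ..., z_N)|^2, the configuration (z_1,...,z_N) being the
   sequence zs of length N (z_{k+1} = nth (0,0) zs k). *)
Definition laughlin_sq {R : realType} (Rc l : R) (p : nat) (zs : seq (R * R)) : R :=
  let N := size zs in
  (kappa Rc l p N) ^+ 2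
  * \prod_(0 <= k < N) \prod_(0 <= j < k)
        (cexp_sqdist Rc (nth (0, 0) zs k) (nth (0, 0) zs j)) ^+ p
  * (expR (- (1 / (2 * l ^+ 2)) * \sum_(0 <= k < N) (nth (0, 0) zs k).1 ^+ 2)) ^+ 2.

(* Iterated Lebesgue integral over Z^n = (R x [0, 2 pi Rc])^n of a function of
   a configuration of n points (the integrands used below are nonnegative, so
   by Tonelli this is the integral over Z^n). *)
Fixpoint iint_Z {R : realType} (Rc : R) (n : nat) (F : seq (R * R) -> \bar R) : \bar R :=
  match n with
  | 0 => F [::]
  | n'.+1 =>
      (\int[@lebesgue_measure R]_x
         \int[@lebesgue_measure R]_(y in `[0%R, (2 * pi * Rc)%R])
            iint_Z Rc n' (fun s => F ((x, y) :: s)))%E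
  end.

Definition CN {R : realType} (Rc l : R) (p N : nat) : \bar R :=
  iint_Z Rc N (fun zs => (laughlin_sq Rc l p zs)%:E).

(* Main.v *)
Require Import Defs.
From HB Require Import structures.
From mathcomp Require Import all_boot all_order all_algebra.
From mathcomp Require Import all_classical all_reals all_analysis.
From mathcomp Require Import ring lra zify.
From mathcomp Require complex.
Import Order.TTheory GRing.Theory Num.Theory.
Local Open Scope classical_set_scope.
Local Open Scope ring_scope.
Set Implicit Arguments. Unset Strict Implicit. Unset Printing Implicit Defensive.

(** Expand the [p]-th power of the Vandermonde product into monomials.  The monomials are
    orthogonal, so [N! C_N] is the sum over exponents [m] of
    [a(m)^2 exp (gam^2 (sum m_i^2 - sum (p k)^2))], where [a(m)] is an integer coefficient.

    If the [k] smallest exponents have the least possible sum [p k (k-1) / 2], then [a] and the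
    Gaussian weight factorize there; decomposing at the first such [k] gives a renewal
    equation [C_N = sum_k alpha_k C_(N-k)] with [alpha_k >= 0] and [alpha_1 = 1].

    The bound [C_(n+n') <= K C_n C_n'] excludes the limit [0].  Given [m], remove the
    exponents in a maximal overcrowded window around the [n]-th smallest exponent.  Beyond the
    window, expanding the factors that couple the left part, the window and the right part
    costs, by Cauchy-Schwarz, at most [exp (O(n^2))] for a window of [n] exponents, while the
    overcrowding makes the Gaussian weight at most [exp (- c n^3)].

    Together with the growth rate [1/r], submultiplicativity up to [K] and supermultiplicativity
    give [1/K <= C_N r^N <= 1], and the Erdos-Feller-Pollard renewal theorem applies. *)

(** * The renewal theorem *)

(** The obstacle is that exponents may pile up without bound at the place of the cut. A game between
    a left and a right player costs a weight that decays exponentially with the distances of their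
    exponents from the cut, so cutting is cheap only if the sum [S] of these weights is bounded.
    Removing the largest window of more than about twice the natural density [1/p] leaves at most
    linearly many exponents within each larger distance, which bounds [S] by a constant of [p] and
    [theta] alone. The window pays for its own removal: [n] exponents within [p n / 4] of a point
    have second moment at most [p^2 n^3 / 16], against about [p^2 n^3 / 12] for spacing [p]. In the
    energy a crossing game enters with the sum of the exponents before and after the cut, both
    measured from the window. Cauchy-Schwarz uses these two halves separately: the first when the
    full configuration is fixed, the second when the parts are fixed. For [p = 0] there is no
    interaction, [C_N = 1/N!], and no finite growth rate exists. *)

Section LimsupBounded.
Context {R : realType}.
Implicit Types (v : nat -> R) (M : R).

Lemma bounded_limsup v M : (forall n, `|v n| <= M) ->
  exists Lam, [/\ `|Lam| <= M,
    forall e, 0 < e -> exists n0, forall k, (n0 <= k)%N -> v k <= Lam + e &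
    forall e n, 0 < e -> exists2 k, (n <= k)%N & Lam - e <= v k].
Proof.
move=> vM; pose E := [set x : R | exists n0, forall k, (n0 <= k)%N -> v k <= x].
have EM : E M by exists 0%N => k _; exact: le_trans (ler_norm _) (vM _).
have lbE : lbound E (- M).
  move=> x [n0 /(_ n0 (leqnn _)) h]; apply: le_trans h.
  by have := vM n0; rewrite ler_norml => /andP[].
have hE : has_inf E by split; [exists M|exists (- M)].
exists (inf E); split.
- rewrite ler_norml; apply/andP; split; first by apply: lb_le_inf => //; exists M.
  by apply: ge_inf => //; exists (- M).
- move=> e e0; have [x [n0 hx] xlt] := inf_adherent e0 hE.
  by exists n0 => k hk; rewrite (le_trans (hx _ hk))// ltW.
- move=> e n e0; apply: contrapT => nex.
  suff : inf E <= inf E - e by lra.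
  apply: ge_inf; first by exists (- M).
  exists n => k hk; rewrite leNgt; apply/negP => lt; apply: nex.
  by exists k => //; exact: ltW.
Qed.

End LimsupBounded.

Section RenewalTheorem.
Import numFieldNormedType.Exports.
Context {R : realType}.
(* [f n] is the weight of a first renewal at time [n.+1]. *)
Variables (u f : nat -> R) (d : R).
Hypothesis u0 : u 0%N = 1.
Hypothesis uS : forall N, u N.+1 = \sum_(n < N.+1) f n * u (N - n)%N.
Hypothesis f_ge0 : forall n, 0 <= f n.
Hypothesis f0_gt0 : 0 < f 0%N.
Hypothesis d_gt0 : 0 < d.
Hypothesis u_ge : forall N, d <= u N.
Hypothesis u_le1 : forall N, u N <= 1.

Let rho j := 1 - \sum_(n < j) f n.

Let rhoS j : rho j.+1 = rho j - f j.
Proof. by rewrite /rho big_ord_recr /= opprD addrA. Qed.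

Let rho_mono i j : (i <= j)%N -> rho j <= rho i.
Proof.
elim: j => [|j IH]; first by rewrite leqn0 => /eqP ->.
rewrite leq_eqVlt => /orP[/eqP ->//|/IH h].
by apply: le_trans h; rewrite rhoS gerBl.
Qed.

(** [rho j] is the probability that the first renewal comes after time [j], so the summand is the
    probability that the last renewal up to time [N] occurs at [N - j]. *)
Lemma renewal_tail_sum N : \sum_(j < N.+1) rho j * u (N - j)%N = 1.
Proof.
elim: N => [|N IH]; first by rewrite big_ord1 /rho big_ord0 subr0 mul1r subn0.
rewrite big_ord_recl /= subn0 {1}/rho big_ord0 subr0 mul1r.
under eq_bigr => j _ do rewrite /bump /= add1n subSS rhoS mulrBl.
by rewrite big_split /= IH sumrN -uS addrCA subrr addr0.
Qed.

(** The total mass of [f] is not bounded a priori. A negative [rho j] would bound all later ones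
    from above, and since [u >= d] the sum in [renewal_tail_sum] would tend to minus infinity
    instead of staying equal to 1. *)
Let rho_ge0 j : 0 <= rho j.
Proof.
rewrite leNgt; apply/negP => rj.
pose A := \sum_(0 <= i < j) `|rho i|.
have B0 : 0 < - rho j * d by rewrite mulr_gt0 ?oppr_gt0.
have [k hk] : exists k : nat, A < k%:R * (- rho j * d).
  exists (Num.truncn (A / (- rho j * d))).+1.
  by rewrite -ltr_pdivrMr// truncnS_gt.
have := renewal_tail_sum (j + k)%N.
rewrite -(big_mkord xpredT (fun i => rho i * u (j + k - i)%N)).
rewrite (@big_cat_nat _ _ _ j)//=; last by rewrite leqW// leq_addr.
have h1 : \sum_(0 <= i < j) rho i * u (j + k - i)%N <= A.
  apply: ler_sum => i _; apply: le_trans (ler_norm _) _.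
  rewrite normrM ler_piMr// ger0_norm ?u_le1//.
  exact: le_trans (ltW d_gt0) (u_ge _).
have h2 : \sum_(j <= i < (j + k).+1) rho i * u (j + k - i)%N <= \sum_(j <= i < (j + k).+1) rho j * d.
  apply: ler_sum_nat => i /andP[ji _].
  apply: (@le_trans _ _ (rho j * u (j + k - i)%N)).
    by apply: ler_wpM2r; [exact: le_trans (ltW d_gt0) (u_ge _)|exact: rho_mono].
  by rewrite ler_nM2l.
have h3 : \sum_(j <= i < (j + k).+1) rho j * d = (k%:R + 1) * (rho j * d).
  by rewrite sumr_const_nat -addnS addKn natr1 mulr_natl.
by move: h1 h2 h3 hk B0 => h1 h2 h3 hk B0 e; lra.
Qed.

Let mu J := \sum_(j < J) rho j.

Let mu_mono i j : (i <= j)%N -> mu i <= mu j.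
Proof.
move=> ij; rewrite /mu -!(big_mkord xpredT) (@big_cat_nat _ _ _ i 0 j)//=.
by rewrite lerDl sumr_ge0.
Qed.

(** Finiteness of the mean renewal time, whose partial sums are [mu J]; the lower bound on [u]
    enters the limit theorem here. *)
Let mu_le J : mu J <= d^-1.
Proof.
apply: le_trans (mu_mono (leqnSn J)) _.
rewrite -[_^-1]mul1r ler_pdivlMr// -(renewal_tail_sum J) mulr_suml.
by apply: ler_sum => j _; rewrite ler_wpM2l.
Qed.

Let rho_small e : 0 < e -> exists n0, forall n, (n0 <= n)%N -> rho n < e.
Proof.
move=> e0; exists (Num.truncn (d^-1 / e)).+1 => n hn.
rewrite ltNge; apply/negP => he.
have : e * n.+1%:R <= d^-1.
  apply: le_trans (mu_le n.+1); rewrite mulr_natr.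
  rewrite -[n.+1 in X in X <= _]card_ord -sumr_const; apply: ler_sum => i _.
  by apply: le_trans he (rho_mono _); rewrite -ltnS.
rewrite mulrC -ler_pdivlMr// => h.
have := truncnS_gt (d^-1 / e); rewrite ltNge => /negP; apply.
by apply: le_trans h; rewrite ler_nat ltnW.
Qed.

Section Limsup.
Variables (v : nat -> R) (Lam : R).
Hypothesis vS : forall N, v N.+1 = \sum_(n < N.+1) f n * v (N - n)%N.
Hypothesis v1 : forall n, `|v n| <= 1.
Hypothesis Lam1 : `|Lam| <= 1.
Hypothesis hup : forall e, 0 < e -> exists n0, forall k, (n0 <= k)%N -> v k <= Lam + e.
Hypothesis hdn : forall e n, 0 < e -> exists2 k, (n <= k)%N & Lam - e <= v k.

(* A near-maximal value is an average of near-maximal bounds, and the value one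
   step earlier has the positive weight [f 0] in it. *)
Lemma near_limsup_pred e : 0 < e ->
  exists2 e', 0 < e' & exists N1, forall N, (N1 <= N)%N ->
    Lam - e' <= v N.+1 -> Lam - e <= v N.
Proof.
(* The estimate below loses less than [5 * e'] in total, which has to stay below [f 0 * e]. *)
move=> e0; pose e' := f 0%N * e / 8.
have e'0 : 0 < e' by rewrite /e' divr_gt0// mulr_gt0.
exists e' => //.
have [n0 hn0] := hup e'0; have [n1 hn1] := rho_small e'0.
exists (n0 + n1)%N => N hN hv.
have h1 : \sum_(1 <= n < N.+1) f n * v (N - n)%N <=
    \sum_(1 <= n < N.+1) f n * (Lam + e') +
    \sum_(1 <= n < N.+1) (if (n < (N - n0).+1)%N then 0 else f n * 2).
  rewrite -big_split /=; apply: ler_sum => n _.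
  (* When [N - n] is too small for [hn0], only [v <= 1 <= Lam + 2] is available; such [n] carry
     little mass. *)
  case: ifPn => hn; first by rewrite addr0 ler_wpM2l// hn0//; lia.
  rewrite -mulrDr ler_wpM2l//.
  move: (v1 (N - n)) Lam1; rewrite !ler_norml; lra.
have h2 : \sum_(1 <= n < N.+1) (if (n < (N - n0).+1)%N then 0 else f n * 2) <= 2 * rho (N - n0).+1.
  rewrite (@big_cat_nat _ _ _ (N - n0).+1)//=; last by rewrite ltnS leq_subr.
  rewrite big_nat big1 ?add0r; last by move=> i /andP[_ ->].
  rewrite big_nat; under eq_bigr => i /andP[hi _] do rewrite ltnNge hi /=.
  rewrite -big_nat -mulr_suml mulrC ler_pM2l//.
  have : rho N.+1 = rho (N - n0).+1 - \sum_((N - n0).+1 <= i < N.+1) f i.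
    rewrite /rho -!(big_mkord xpredT f) (@big_cat_nat _ _ _ (N - n0).+1 0 N.+1)//=; last by rewrite ltnS leq_subr.
    by rewrite opprD addrA.
  by have := rho_ge0 N.+1; lra.
have h3 : \sum_(1 <= n < N.+1) f n * (Lam + e') = (1 - rho N.+1 - f 0%N) * (Lam + e').
  rewrite -mulr_suml; congr (_ * _).
  by rewrite /rho -(big_mkord xpredT f) big_ltn//; ring.
have h4 : v N.+1 = f 0%N * v N + \sum_(1 <= n < N.+1) f n * v (N - n)%N.
  by rewrite vS -(big_mkord xpredT (fun n => f n * v (N - n)%N)) big_ltn// subn0.
have h5 : rho N.+1 < e' by apply: hn1; lia.
have h6 : rho (N - n0).+1 < e' by apply: hn1; lia.
have h7 := rho_ge0 N.+1.
have f01 : f 0%N <= 1.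
  by have := rho_ge0 1; rewrite /rho big_ord1; lra.
have : f 0%N * (Lam - e) <= f 0%N * v N.
  have E : f 0%N * e = 8 * e' by rewrite /e'; field.
  rewrite mulrBr E.
  have : (1 - rho N.+1 - f 0%N) * (Lam + e') <= (1 - f 0%N) * Lam + e' + rho N.+1.
    move: Lam1; rewrite ler_norml => /andP[a b]; nra.
  move: h1 h2 h3 h4 hv; lra.
by rewrite ler_pM2l.
Qed.

(** Iterates [near_limsup_pred] backwards [J] times with shrinking tolerances. It is applied to [u]
    and to [- u], giving long stretches near the upper and near the lower limit. *)
Lemma near_limsup_window J e n : 0 < e ->
  exists N, [/\ (n <= N)%N, (J <= N)%N & forall j, (j <= J)%N -> Lam - e <= v (N - j)%N].
Proof.
have step : forall J e, 0 < e -> exists2 e', 0 < e' & exists N1, forall N,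
    (N1 <= N)%N -> Lam - e' <= v N -> (J <= N)%N /\ forall j, (j <= J)%N -> Lam - e <= v (N - j)%N.
  elim=> [|J' IH] e1 e10.
    by exists e1 => //; exists 0%N => N _ h; split=> // j; rewrite leqn0 => /eqP ->; rewrite subn0.
  have [e2 e20 [N2 h2]] := near_limsup_pred e10.
  pose e3 := Num.min e1 e2; have e30 : 0 < e3 by rewrite lt_min e10.
  have [e4 e40 [N4 h4]] := IH _ e30.
  exists e4 => //; exists (N2 + N4 + J'.+1)%N => N hN /h4[|JN hj]; first lia.
  split=> [|j]; first lia.
  rewrite leq_eqVlt => /orP[/eqP ->|hjJ].
    apply: h2; first lia.
    have -> : (N - J'.+1).+1 = (N - J')%N by lia.
    by apply: le_trans (hj _ (leqnn _)); rewrite lerB// ge_min lexx orbT.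
  by apply: le_trans (hj j _) => //; rewrite lerB// ge_min lexx.
move=> /(step J)[e' e'0 [N1 h]]; have [k hk hv] := hdn (n + N1)%N e'0.
exists k; have [|? ?] := h k _ hv; first lia.
by split => //; lia.
Qed.

End Limsup.

Theorem renewal_limit : exists2 L : R, 0 < L & u @ \oo --> L.
Proof.
have un : forall n, `|u n| <= 1.
  move=> n; rewrite ger0_norm//; exact: le_trans (ltW d_gt0) (u_ge _).
pose E := range mu.
have hE : has_sup E.
  split; first by exists (mu 0), 0%N.
  by exists d^-1 => _ [J _ <-]; exact: mu_le.
pose m := sup E.
have mum J : mu J <= m by apply: ub_le_sup; [case: hE|exists J].
have m1 : 1 <= m by have := mum 1%N; rewrite /mu big_ord1 /rho big_ord0 subr0.
have m0 : 0 < m by lra.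
have [La [La1 Lau Lad]] := bounded_limsup un.
have [Lb [Lb1 Lbu Lbd]] : exists Lam, [/\ `|Lam| <= 1,
    forall e, 0 < e -> exists n0, forall k, (n0 <= k)%N -> - u k <= Lam + e &
    forall e n, 0 < e -> exists2 k, (n <= k)%N & Lam - e <= - u k].
  by apply: bounded_limsup => n; rewrite normrN.
have nuS N : - u N.+1 = \sum_(n < N.+1) f n * - u (N - n)%N.
  by rewrite uS -sumrN; apply: eq_bigr => n _; rewrite mulrN.
(* On a stretch where [u] is near [La], the first [J] terms of [renewal_tail_sum] are about
   [La * mu J], and the other terms are nonnegative. *)
have La_le : La <= m^-1.
  rewrite -[_^-1]mul1r ler_pdivlMr//; apply/ler_addgt0Pr => e e0.
  pose e1 := e / (m + 1); have e10 : 0 < e1 by rewrite divr_gt0//; lra.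
  have [_ [J _ <-] hJ] := sup_adherent e10 hE.
  have [N [_ JN hN]] := near_limsup_window uS un La1 Lau Lad J 0 e10.
  have := renewal_tail_sum N; rewrite -(big_mkord xpredT (fun j => rho j * u (N - j)%N)).
  rewrite (@big_cat_nat _ _ _ J)//=; last exact: leqW.
  have h1 : (La - e1) * mu J <= \sum_(0 <= j < J) rho j * u (N - j)%N.
    rewrite mulrC /mu mulr_suml -(big_mkord xpredT (fun j => rho j * (La - e1))).
    by apply: ler_sum_nat => j /andP[_ hj]; rewrite ler_wpM2l// hN// ltnW.
  have h2 : 0 <= \sum_(J <= j < N.+1) rho j * u (N - j)%N.
    by apply: sumr_ge0 => j _; rewrite mulr_ge0//; exact: le_trans (ltW d_gt0) (u_ge _).
  have h3 : e1 * (m + 1) = e by rewrite /e1 divfK//; lra.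
  have := mum J; have : 0 <= mu J by apply: sumr_ge0.
  move: La1 hJ h1 h2 h3; rewrite ler_norml -/m => /andP[? ?] hJ h1 h2 h3 mu0 muJ e4.
  nra.
(* [- Lb] is the lower limit of [u]. The terms beyond [J] can no longer be dropped, but [u <= 1]
   bounds them by [m - mu J]. *)
have Lb_ge : m^-1 <= - Lb.
  rewrite -[_^-1]mul1r ler_pdivrMr//; apply/ler_addgt0Pr => e e0.
  pose e1 := e / (m + 2); have e10 : 0 < e1 by rewrite divr_gt0//; lra.
  have [_ [J _ <-] hJ] := sup_adherent e10 hE.
  have nun n : `|- u n| <= 1 by rewrite normrN.
  have [N [_ JN hN]] := near_limsup_window nuS nun Lb1 Lbu Lbd J 0 e10.
  have := renewal_tail_sum N; rewrite -(big_mkord xpredT (fun j => rho j * u (N - j)%N)).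
  rewrite (@big_cat_nat _ _ _ J)//=; last exact: leqW.
  have h1 : \sum_(0 <= j < J) rho j * u (N - j)%N <= (- Lb + e1) * mu J.
    rewrite mulrC /mu mulr_suml -(big_mkord xpredT (fun j => rho j * (- Lb + e1))).
    apply: ler_sum_nat => j /andP[_ hj]; rewrite ler_wpM2l//.
    by have := hN j (ltnW hj); lra.
  have h2 : \sum_(J <= j < N.+1) rho j * u (N - j)%N <= m - mu J.
    apply: (@le_trans _ _ (\sum_(J <= j < N.+1) rho j)).
      by apply: ler_sum => j _; rewrite ler_piMr.
    have := mum N.+1; rewrite /mu -!(big_mkord xpredT) (@big_cat_nat _ _ _ J 0 N.+1)//=; [lra|exact: leqW].
  have h3 : e1 * (m + 2) = e by rewrite /e1 divfK//; lra.
  have := mum J; have : 0 <= mu J by apply: sumr_ge0.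
  move: Lb1 hJ h1 h2 h3; rewrite ler_norml -/m => /andP[? ?] hJ h1 h2 h3 mu0 muJ e4.
  nra.
exists m^-1; first by rewrite invr_gt0.
apply/cvgrPdist_le => e e0.
have [n1 h1] := Lau _ e0; have [n2 h2] := Lbu _ e0.
exists (n1 + n2)%N => // n /= hn; rewrite ler_norml.
have := h1 n; have := h2 n; rewrite !(leq_trans _ hn) ?leq_addr ?leq_addl// => /(_ isT) a /(_ isT) b.
apply/andP; split; lra.
Qed.

End RenewalTheorem.

(** * Expansion of the Vandermonde product by tournaments *)

Section Tournament.
Variable (p : nat).
Implicit Types (I J A B : finType).

(* Every pair of players meets [p] times and [f (i, j)] is the number of wins of [i] over [j]:
   in the expansion of [prod_(i < j) (Z_j - Z_i)^p], [Z_i] is chosen from [f (i, j)] of the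
   [p] factors [Z_j - Z_i], which produces the monomial with exponents [score f]. *)
Definition tournament I (f : {ffun I * I -> 'I_p.+1}) : bool :=
  [forall x : I * I, (f x + f (x.2, x.1) == if x.1 == x.2 then 0 else p)%N].

Definition score I (f : {ffun I * I -> 'I_p.+1}) : {ffun I -> nat} :=
  [ffun i => \sum_j f (i, j)]%N.

Lemma tournamentP I (f : {ffun I * I -> 'I_p.+1}) :
  reflect ((forall i : I, f (i, i) = 0%N :> nat) /\
           (forall i j : I, i != j -> (f (i, j) + f (j, i) = p)%N))
          (tournament f).
Proof.
apply: (iffP forallP) => [h|[h1 h2] [i j] /=].
  split=> [i|i j ij]; first by have /= := h (i, i); rewrite eqxx; lia.
  by have /= /eqP := h (i, j); rewrite (negPf ij).
by have [->|ij] := eqVneq i j; [rewrite h1|rewrite h2].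
Qed.

Lemma tournament_diag I f (i : I) : tournament f -> f (i, i) = 0%N :> nat.
Proof. by move=> /tournamentP[]. Qed.

Lemma tournament_opp I f (i j : I) : tournament f -> i != j -> (f (j, i) = p - f (i, j) :> nat)%N.
Proof. by move=> /tournamentP[_ h] /h; lia. Qed.

(* [o] orients the pairs; for symmetric summands the orientation is irrelevant. *)
Lemma big_orient (S : Type) (idx : S) (op : Monoid.com_law idx) I (o o' : I -> nat)
    (h : I * I -> S) : injective o -> injective o' -> (forall i j, i != j -> h (i, j) = h (j, i)) ->
  \big[op/idx]_(x : I * I | (o x.1 < o x.2)%N) h x =
  \big[op/idx]_(x : I * I | (o' x.1 < o' x.2)%N) h x.
Proof.
move=> io io' hs.
pose sw (x : I * I) := (x.2, x.1).
have swK : involutive sw by case.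
rewrite (bigID (fun x : I * I => o' x.1 < o' x.2)%N) /=.
rewrite [RHS](bigID (fun x : I * I => o x.1 < o x.2)%N) /=.
congr (op _ _); first by apply: eq_bigl => x; rewrite andbC.
rewrite (reindex_inj (inv_inj swK)) /=; apply: eq_big => [[i j]/=|[i j] /=].
  have [->|ij] := eqVneq i j; first by rewrite !ltnn.
  have : o i != o j by apply: contra_neq ij; exact: io.
  have : o' i != o' j by apply: contra_neq ij; exact: io'.
  rewrite -!leqNgt; lia.
move=> /= /andP[oij _]; rewrite /sw /= hs//.
by apply: contraTneq oij => ->; rewrite ltnn.
Qed.

Section Distr.
Variables (K : comRingType) (I : finType) (o : I -> nat).
Hypothesis io : injective o.

Lemma tournament_distr (F : I * I -> 'I_p.+1 -> K) :
  \sum_(f | tournament f) \prod_(x : I * I | (o x.1 < o x.2)%N) F x (f x) =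
  \prod_(x : I * I | (o x.1 < o x.2)%N) \sum_e F x e.
Proof.
rewrite (big_distr_big ord0) /=.
(* [big_distr_big] ranges over functions equal to [ord0] off the oriented pairs. [up] erases the
   reversed results, and [dn] restores them as [p] minus the oriented ones. *)
pose up (f : {ffun I * I -> 'I_p.+1}) := [ffun x : I * I => if (o x.1 < o x.2)%N then f x else ord0].
pose dn (f : {ffun I * I -> 'I_p.+1}) := [ffun x : I * I => if (o x.1 < o x.2)%N then f x else
   if (o x.2 < o x.1)%N then rev_ord (f (x.2, x.1)) else ord0].
rewrite [RHS](reindex_onto up dn) /=; last first.
  move=> f /pffun_onP[/supportP hf _]; apply/ffunP => x; rewrite !ffunE.
  case: ifPn => [->//|hx]; by rewrite hf.
apply: eq_big => [f|f _]; last by apply: eq_bigr => x hx; rewrite ffunE hx.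
apply/tournamentP/idP => [[h1 h2]|/andP[_ /eqP <-]].
  apply/andP; split.
    apply/pffun_onP; split=> [|y _]; last by [].
    by apply/supportP => x; rewrite unfold_in /= ffunE => /negPf ->.
  apply/eqP/ffunP => -[i j]; rewrite !ffunE /=.
  have [//|ji|/io ij] := ltngtP (o i) (o j).
    apply/val_inj => /=; rewrite subSS; have := h2 i j.
    have -> : i != j by apply: contraTneq ji => ->; rewrite ltnn.
    by move=> /(_ isT); lia.
  by apply/val_inj; rewrite ij /= h1.
split=> [i|i j ij]; first by rewrite ffunE /= ltnn.
have : o i != o j by apply: contra_neq ij; exact: io.
rewrite !ffunE /= neq_ltn.
have := ltn_ord (f (i, j)); have := ltn_ord (f (j, i)).
by have [oij|oij|//] := ltngtP (o i) (o j) => /= h3 h4 _; rewrite subSS; lia.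
Qed.

Definition tweight (f : {ffun I * I -> 'I_p.+1}) : K :=
  \prod_(x : I * I | (o x.1 < o x.2)%N) ((-1) ^+ f x * 'C(p, f x)%:R).

Lemma tournament_monomial (f : {ffun I * I -> 'I_p.+1}) (Z : I -> K) : tournament f ->
  \prod_(x : I * I | (o x.1 < o x.2)%N) (Z x.1 ^+ f x * Z x.2 ^+ (p - f x)) =
  \prod_i Z i ^+ score f i.
Proof.
move=> tf; under [RHS]eq_bigr => i _ do rewrite ffunE -prodrXr.
rewrite [RHS]pair_bigA /= [RHS](bigID (fun x : I * I => (o x.1 < o x.2)%N)) /= [LHS]big_split /=; congr (_ * _).
  by apply: eq_bigr => -[].
pose sw (x : I * I) := (x.2, x.1).
have swK : involutive sw by case.
rewrite [RHS](reindex_inj (inv_inj swK)) /= [RHS](bigID (fun x : I * I => (o x.1 < o x.2)%N)) /=.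
rewrite [X in _ = _ * X]big1 ?mulr1; last first.
  move=> [i j] /=; rewrite -!leqNgt => ij; have /io -> : o i = o j by lia.
  by rewrite tournament_diag// expr0.
apply: eq_big => [[i j] /=|[i j] /= ij]; first by rewrite -leqNgt andb_idl//; exact: ltnW.
by rewrite (@tournament_opp _ f i j)//; apply: contraTneq ij => ->; rewrite ltnn.
Qed.

Lemma vandermonde_tournament (Z : I -> K) :
  \prod_(x : I * I | (o x.1 < o x.2)%N) (Z x.2 - Z x.1) ^+ p =
  \sum_(f | tournament f) tweight f * \prod_i Z i ^+ score f i.
Proof.
under eq_bigr => x _ do rewrite exprDn.
rewrite -(tournament_distr (fun x e => Z x.2 ^+ (p - e) * (- Z x.1) ^+ e *+ 'C(p, e))).
apply: eq_bigr => f tf; rewrite -tournament_monomial// /tweight -big_split /=.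
apply: eq_bigr => x _; rewrite -[LHS]mulr_natl [(- Z _) ^+ _]exprNn.
by rewrite mulrC [RHS]mulrAC; congr (_ * _); rewrite mulrC -mulrA.
Qed.

End Distr.

Section Glue.
Variables A B : finType.

(** [g (a, b)] counts the wins of [a] over [b], and [rev_ord] turns it into the [p - g (a, b)] wins
    of [b]. Every tournament on [A + B] arises exactly once. *)
Definition glue (fA : {ffun A * A -> 'I_p.+1}) (fB : {ffun B * B -> 'I_p.+1})
    (g : {ffun A * B -> 'I_p.+1}) : {ffun (A + B) * (A + B) -> 'I_p.+1} :=
  [ffun x : (A + B) * (A + B) => match x with
    | (inl a, inl a') => fA (a, a')
    | (inr b, inr b') => fB (b, b')
    | (inl a, inr b) => g (a, b)
    | (inr b, inl a) => rev_ord (g (a, b)) end].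

Lemma tournament_glue fA fB g : tournament (glue fA fB g) = tournament fA && tournament fB.
Proof.
apply/tournamentP/andP => [[h1 h2]|[/tournamentP[hA1 hA2] /tournamentP[hB1 hB2]]].
  split; apply/tournamentP; split.
  - by move=> a; have := h1 (inl a); rewrite ffunE.
  - by move=> a a' aa; have := h2 (inl a) (inl a') aa; rewrite !ffunE.
  - by move=> a; have := h1 (inr a); rewrite ffunE.
  - by move=> a a' aa; have := h2 (inr a) (inr a') aa; rewrite !ffunE.
split; first by case=> x; rewrite ffunE.
by case=> [a|b] [a'|b'] xy; rewrite !ffunE /= ?hA2 ?hB2//; [have := ltn_ord (g (a, b'))|have := ltn_ord (g (a', b))]; rewrite subSS; lia.
Qed.

Lemma big_tournament_sum (K : comRingType) (F : {ffun (A + B) * (A + B) -> 'I_p.+1} -> K) :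
  \sum_(f | tournament f) F f =
  \sum_(fA | tournament fA) \sum_(fB | tournament fB) \sum_g F (glue fA fB g).
Proof.
under [RHS]eq_bigr => fA _ do rewrite pair_big_dep /=.
rewrite pair_big_dep /=.
pose dn (f : {ffun (A + B) * (A + B) -> 'I_p.+1}) :=
  ([ffun x : A * A => f (inl x.1, inl x.2)], ([ffun x : B * B => f (inr x.1, inr x.2)],
   [ffun x : A * B => f (inl x.1, inr x.2)])).
rewrite (reindex_onto (fun y : _ * (_ * _) => glue y.1 y.2.1 y.2.2) dn) /=; last first.
  move=> f /tournamentP[h1 h2]; apply/ffunP => -[[a|b] [a'|b']]; rewrite !ffunE //=.
  apply/val_inj; rewrite /= subSS.
  apply: (@addnI (f (inl a', inr b))); rewrite subnKC; last by rewrite -ltnS; exact: ltn_ord.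
  exact/esym/(h2 (inl a') (inr b)).
apply: eq_bigl => -[fA [fB g]] /=.
have -> : dn (glue fA fB g) = (fA, (fB, g)).
  by congr (_, (_, _)); apply/ffunP => -[? ?]; rewrite !ffunE.
by rewrite eqxx andbT tournament_glue andbT.
Qed.

Lemma score_glue_inl fA fB g a :
  score (glue fA fB g) (inl a) = (score fA a + \sum_b g (a, b))%N.
Proof.
by rewrite !ffunE big_sumType /=; congr (_ + _)%N; apply: eq_bigr => i _; rewrite ffunE.
Qed.

Lemma score_glue_inr fA fB g b :
  score (glue fA fB g) (inr b) = (\sum_a (p - g (a, b)) + score fB b)%N.
Proof.
by rewrite !ffunE big_sumType /=; congr (_ + _)%N; apply: eq_bigr => i _; rewrite ffunE.
Qed.

Lemma big_pair_sum (S : Type) (idx : S) (op : Monoid.com_law idx) (P : pred ((A + B) * (A + B)))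
  (F : (A + B) * (A + B) -> S) :
  \big[op/idx]_(x | P x) F x =
  op (op (\big[op/idx]_(x : A * A | P (inl x.1, inl x.2)) F (inl x.1, inl x.2))
         (\big[op/idx]_(x : A * B | P (inl x.1, inr x.2)) F (inl x.1, inr x.2)))
     (op (\big[op/idx]_(x : B * A | P (inr x.1, inl x.2)) F (inr x.1, inl x.2))
         (\big[op/idx]_(x : B * B | P (inr x.1, inr x.2)) F (inr x.1, inr x.2))).
Proof.
have h (C D : finType) (P' : pred (C * D)) (F' : C * D -> S) :
    \big[op/idx]_(x : C * D | P' x) F' x = \big[op/idx]_c \big[op/idx]_d (if P' (c, d) then F' (c, d) else idx).
  by rewrite pair_bigA /= big_mkcond /=; apply: eq_bigr => -[].
rewrite !h big_sumType /= -!big_split /=; congr (op _ _); apply: eq_bigr => i _.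
  by rewrite big_sumType.
by rewrite big_sumType.
Qed.

Lemma tweight_glue (K : comRingType) (o : A + B -> nat) fA fB g :
  (forall a b, o (inl a) < o (inr b))%N ->
  tweight K o (glue fA fB g) =
  tweight K (o \o inl) fA * tweight K (o \o inr) fB *
  \prod_(x : A * B) ((-1) ^+ g x * 'C(p, g x)%:R).
Proof.
move=> oAB; rewrite /tweight big_pair_sum /=.
rewrite [X in _ * (X * _)]big_pred0 ?mul1r; last first.
  by case=> b a /=; apply/negbTE; rewrite -leqNgt ltnW.
rewrite -mulrA [X in _ * X = _]mulrC mulrA; congr (_ * _ * _).
- by apply: eq_bigr => -[x y] _; rewrite ffunE.
- by apply: eq_bigr => -[x y] _; rewrite ffunE.
- by apply: eq_big => -[x y] /=; rewrite ?oAB// ffunE.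
Qed.

End Glue.

End Tournament.

(** * Weighted sums of squared coefficients *)

Section TournamentSums.
Context {R : realType}.
Variables (p : nat) (theta : R).
Implicit Types (I J : finType).

(* Equal to the sum over [m] of [T m] times the squared coefficient of [Z^m], see [tsum_coef].
   Unlike a coefficient, the product of two weights is symmetric under relabelling. *)
Definition tsum I (o : I -> nat) (T : {ffun I -> nat} -> R) : R :=
  \sum_(f : {ffun I * I -> 'I_p.+1} | tournament f)
    \sum_(g : {ffun I * I -> 'I_p.+1} | tournament g && (score g == score f))
      tweight R o f * tweight R o g * T (score f).

(** Reversing a pair replaces the sign exponent [f + g] by [(p - f) + (p - g)], which has the same
    parity, and the binomials are symmetric. A single weight could change sign. *)
Lemma tweight2_orient I (o o' : I -> nat) (f g : {ffun I * I -> 'I_p.+1}) :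
  injective o -> injective o' -> tournament f -> tournament g ->
  tweight R o f * tweight R o g = tweight R o' f * tweight R o' g.
Proof.
move=> io io' tf tg; rewrite /tweight -!big_split /=; apply: big_orient => // i j ij.
have [/= fp gp] : (f (i, j) <= p)%N /\ (g (i, j) <= p)%N by split; rewrite -ltnS ltn_ord.
rewrite [in RHS]tournament_opp// [in RHS](tournament_opp tg ij) !bin_sub//.
rewrite !mulrA; congr (_ * _); rewrite mulrAC [RHS]mulrAC; congr (_ * _).
rewrite -!exprD -signr_odd -[RHS]signr_odd; congr (_ ^+ nat_of_bool _).
by rewrite !oddD !oddB//; case: (odd p); case: (odd (f _)); case: (odd (g _)).
Qed.

Lemma tsum_orient I (o o' : I -> nat) T :
  injective o -> injective o' -> tsum o T = tsum o' T.
Proof.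
move=> io io'; apply: eq_bigr => f tf; apply: eq_bigr => g /andP[tg _].
by rewrite (tweight2_orient io io').
Qed.

Lemma tsum_bij I J (phi : I -> J) (psi : J -> I) (o : J -> nat) T :
  cancel phi psi -> cancel psi phi ->
  tsum o T = tsum (o \o phi) (fun m => T [ffun j => m (psi j)]).
Proof.
move=> phiK psiK.
pose tr (f : {ffun I * I -> 'I_p.+1}) : {ffun J * J -> 'I_p.+1} := [ffun x : J * J => f (psi x.1, psi x.2)].
pose rt (f : {ffun J * J -> 'I_p.+1}) : {ffun I * I -> 'I_p.+1} := [ffun x : I * I => f (phi x.1, phi x.2)].
have trK : cancel tr rt by move=> f; apply/ffunP => -[i j]; rewrite !ffunE /= !phiK.
have rtK : cancel rt tr by move=> f; apply/ffunP => -[i j]; rewrite !ffunE /= !psiK.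
have t_tr f : tournament (tr f) = tournament f.
  apply/tournamentP/tournamentP => -[h1 h2]; split.
  - by move=> i; have := h1 (phi i); rewrite ffunE /= phiK.
  - move=> i j ij; have := h2 (phi i) (phi j); rewrite !ffunE /= !phiK; apply.
    by rewrite (can_eq phiK).
  - by move=> i; rewrite ffunE /= h1.
  - by move=> i j ij; rewrite !ffunE /= h2// (can_eq psiK).
have s_tr f : score (tr f) = [ffun j => score f (psi j)].
  apply/ffunP => j; rewrite !ffunE (reindex phi) /=; last by exists psi => ? _.
  by apply: eq_bigr => i _; rewrite ffunE /= phiK.
have w_tr f : tweight R o (tr f) = tweight R (o \o phi) f.
  rewrite /tweight (reindex (fun x : I * I => (phi x.1, phi x.2))) /=; last first.
    by exists (fun x => (psi x.1, psi x.2)) => -[i j] _ /=; rewrite ?phiK ?psiK.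
  by apply: eq_bigr => -[i j] _; rewrite ffunE /= !phiK.
rewrite /tsum (reindex tr) /=; last by exists rt => ? _.
apply: eq_big => [f|f _]; first by rewrite t_tr.
rewrite (reindex tr) /=; last by exists rt => ? _.
apply: eq_big => [g|g _]; last by rewrite !w_tr s_tr.
rewrite t_tr !s_tr; congr (_ && _); apply/eqP/eqP => [e|->//].
by apply/ffunP => i; move/ffunP: e => /(_ (phi i)); rewrite !ffunE phiK.
Qed.

Lemma tsum_relabel I J (phi : I -> J) (psi : J -> I) (oI : I -> nat) (oJ : J -> nat) T :
  injective oI -> injective oJ -> cancel phi psi -> cancel psi phi ->
  tsum oJ T = tsum oI (fun m => T [ffun j => m (psi j)]).
Proof.
move=> ioI ioJ phiK psiK; rewrite (tsum_bij _ _ phiK psiK).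
by apply: tsum_orient => //; apply: inj_comp => //; exact: can_inj phiK.
Qed.

(** By [vandermonde_tournament], the coefficient of [Z^m] in the [p]-th power of the Vandermonde
    product. *)
Definition coef I (o : I -> nat) (m : {ffun I -> nat}) : R :=
  \sum_(f : {ffun I * I -> 'I_p.+1} | tournament f && (score f == m)) tweight R o f.

(** Bounded exponents form a finite type, over which [\sum] is available; scores are bounded by
    [#|I| * p]. *)
Definition natf I B (m : {ffun I -> 'I_B}) : {ffun I -> nat} := [ffun i => m i : nat].

Lemma score_lt I B (f : {ffun I * I -> 'I_p.+1}) i :
  (#|I| * p < B)%N -> (score f i < B)%N.
Proof.
apply: leq_ltn_trans; rewrite ffunE -sum_nat_const.
by apply: leq_sum => j _; rewrite -ltnS.
Qed.

Lemma natf_score I B (f : {ffun I * I -> 'I_p.+1}) : (#|I| * p < B.+1)%N ->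
  natf [ffun i => inord (score f i) : 'I_B.+1] = score f.
Proof. by move=> hB; apply/ffunP => i; rewrite ffunE /= ffunE inordK// score_lt. Qed.

Lemma natf_inj I B : injective (@natf I B).
Proof.
move=> m m' /ffunP e; apply/ffunP => i; apply/val_inj.
by have := e i; rewrite !ffunE.
Qed.

Lemma tsum_coef I (o : I -> nat) T B : (#|I| * p < B.+1)%N ->
  tsum o T = \sum_(m : {ffun I -> 'I_B.+1}) T (natf m) * coef o (natf m) ^+ 2.
Proof.
move=> hB; rewrite /tsum (partition_big (fun f => [ffun i => inord (score f i) : 'I_B.+1]) xpredT) //=.
apply: eq_bigr => m _; rewrite expr2 mulrA mulrC mulr_suml.
apply: eq_big => [f|f /andP[tf /eqP <-]].
  by congr (_ && _); rewrite -(inj_eq (@natf_inj _ _)) natf_score.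
rewrite natf_score// mulrA mulr_sumr; apply: eq_bigr => g _.
by rewrite mulrAC.
Qed.

(** The products of two weights have no sign, so monotonicity is not termwise; it holds after
    grouping into the squares of [tsum_coef]. *)
Lemma ler_tsum I (o : I -> nat) T T' :
  (forall f : {ffun I * I -> 'I_p.+1}, tournament f -> T (score f) <= T' (score f)) -> tsum o T <= tsum o T'.
Proof.
move=> h; have hB := ltnSn (#|I| * p); rewrite !(tsum_coef _ _ hB).
apply: ler_sum => m _.
have [/existsP[f /andP[tf /eqP sf]]|/existsPn nf] :=
    boolP [exists f : {ffun I * I -> 'I_p.+1}, tournament f && (score f == natf m)].
  by rewrite -sf ler_wpM2r ?sqr_ge0// h.
by rewrite /coef big_pred0 ?expr0n ?mulr0// => f; apply/negbTE.
Qed.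

Lemma tsum_ge0 I (o : I -> nat) T : (forall m, 0 <= T m) -> 0 <= tsum o T.
Proof.
move=> h; rewrite (tsum_coef _ _ (ltnSn _)).
by apply: sumr_ge0 => m _; rewrite mulr_ge0 ?sqr_ge0.
Qed.

Lemma eq_tsum I (o : I -> nat) T T' :
  (forall f : {ffun I * I -> 'I_p.+1}, tournament f -> T (score f) = T' (score f)) -> tsum o T = tsum o T'.
Proof. by move=> h; apply: eq_bigr => f tf; apply: eq_bigr => g _; rewrite h. Qed.

Lemma tsum_sum I (o : I -> nat) (X : finType) (P : pred X) (T : X -> {ffun I -> nat} -> R) :
  tsum o (fun m => \sum_(x | P x) T x m) = \sum_(x | P x) tsum o (T x).
Proof.
rewrite /tsum exchange_big; apply: eq_bigr => f _; rewrite exchange_big.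
by apply: eq_bigr => g _; rewrite mulr_sumr.
Qed.

Lemma sum_score I (f : {ffun I * I -> 'I_p.+1}) : tournament f ->
  (2 * \sum_i score f i = p * (#|I| * #|I|.-1))%N.
Proof.
move=> tf; under eq_bigr => i _ do rewrite ffunE.
rewrite mul2n -addnn {2}exchange_big /= -big_split /=.
under eq_bigr => i _.
  rewrite -big_split /= (bigD1 i)//= tournament_diag// addn0 add0n.
  under eq_bigr => j ji do rewrite (tournament_opp tf ji) subnK ?(ltn_ord (f _) : (f _ <= p)%N)//.
  rewrite sum_nat_const (_ : #|_| = #|I|.-1); last first.
    by rewrite -(cardC1 i); apply: eq_card.
  over.
by rewrite sum_nat_const; ring.
Qed.

Lemma score_le I (f : {ffun I * I -> 'I_p.+1}) i : tournament f ->
  (score f i <= p * #|I|.-1)%N.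
Proof.
move=> tf; rewrite ffunE (bigD1 i)//= tournament_diag// add0n.
rewrite -(cardC1 i) mulnC -sum_nat_const.
have -> : (\sum_(j in predC1 i) p = \sum_(j | j != i) p)%N by apply: eq_bigl.
by apply: leq_sum => j _; rewrite -ltnS.
Qed.

(** The reference exponents [p * k] are the scores of the tournament in which the order decides
    every game. The base point [z] is kept free so that it can be put at the window. *)
Definition energy I (m : {ffun I -> nat}) (z : R) : R :=
  \sum_i ((m i)%:R - z) ^+ 2 - \sum_(k < #|I|) ((p * k)%:R - z) ^+ 2.

Definition gweight I (m : {ffun I -> nat}) : R := expR (theta * energy m 0).

(** Both families have the same size and the same sum, so the terms containing [z] cancel. *)
Lemma energy_shift I (m : {ffun I -> nat}) z :
  (2 * \sum_i m i = p * (#|I| * #|I|.-1))%N -> energy m z = energy m 0.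
Proof.
move=> hm.
have hk : (2 * \sum_(k < #|I|) p * k = p * (#|I| * #|I|.-1))%N.
  rewrite -big_distrr /= mulnCA; congr (p * _)%N.
  elim: #|I| => [|n IH]; first by rewrite big_ord0.
  by rewrite big_ord_recr /= mulnDr IH; case: n {IH} => // n; rewrite /=; ring.
have hr : \sum_i (m i)%:R = \sum_(k < #|I|) (p * k)%:R :> R.
  by rewrite -!natr_sum; congr (_%:R); apply/eqP; rewrite -(eqn_pmul2l (isT : 0 < 2)%N) hm hk.
have ex (X : finType) (a : X -> R) : \sum_x (a x - z) ^+ 2 = \sum_x (a x - 0) ^+ 2 - 2 * z * \sum_x a x + \sum_(x : X) z ^+ 2.
  rewrite mulr_sumr -sumrB -big_split /=; apply: eq_bigr => x _; ring.
rewrite /energy !ex hr !sumr_const card_ord; ring.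
Qed.

(* The squared norm of Laughlin's function, see [CN_cc]. *)
Definition cc N : R := tsum (@nat_of_ord N) (@gweight 'I_N) / N`!%:R.

Lemma gweight_gt0 I (m : {ffun I -> nat}) : 0 < gweight m.
Proof. exact: expR_gt0. Qed.

(** The weight is symmetric, hence only the cardinality matters. This recognizes [cc] on blocks
    indexed by subtypes and summands. *)
Lemma tsum_card I (o : I -> nat) : injective o ->
  tsum o (@gweight I) = (#|I|)`!%:R * cc #|I|.
Proof.
move=> io; rewrite /cc mulrC divfK ?pnatr_eq0 -?lt0n ?fact_gt0//.
rewrite (tsum_relabel _ (@ord_inj _) io (@enum_valK I) (@enum_rankK I)).
apply: eq_tsum => f _; rewrite /gweight /energy card_ord; congr expR; congr (_ * (_ - _)).
rewrite (reindex (@enum_val I I)) /=; last by exists enum_rank => ? _; rewrite ?enum_valK ?enum_rankK.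
by apply: eq_bigr => i _; rewrite !ffunE enum_valK.
Qed.

Lemma cc_ge0 N : 0 <= cc N.
Proof. by rewrite divr_ge0// tsum_ge0// => m; exact/ltW/gweight_gt0. Qed.

End TournamentSums.

(** * Renewal equation *)

Section Renewal.
Context {R : realType}.
Variables (p : nat) (theta : R).
Implicit Types (I A B : finType).

(* The [k] smallest exponents of [m] have the least possible sum [p k (k-1) / 2];
   for a score sequence they are then exactly the exponents below [p k]. *)
Definition renewal_at I k (m : {ffun I -> nat}) : bool :=
  (\sum_(i | m i < p * k) 1 == k)%N && (2 * \sum_(i | m i < p * k) m i == p * (k * k.-1))%N.

Definition no_renewal_below I n (m : {ffun I -> nat}) : bool :=
  [forall k : 'I_n, (0 < k)%N ==> ~~ renewal_at k m].

(** The weight [alpha_N] of the renewal equation: [N] is always a renewal by [renewal_at_full], so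
    excluding all smaller positive ones makes it the first. *)
Definition irr_weight N : R :=
  tsum p (@nat_of_ord N) (fun m => gweight p theta m * (no_renewal_below N m)%:R) / N`!%:R.

Lemma irr_weight_ge0 N : 0 <= irr_weight N.
Proof.
by rewrite divr_ge0// tsum_ge0// => m; rewrite mulr_ge0// ltW// gweight_gt0.
Qed.

Lemma sum_base_add a b (z : R) :
  \sum_(k < a + b) ((p * k)%:R - z) ^+ 2 =
  \sum_(k < a) ((p * k)%:R - z) ^+ 2 + \sum_(k < b) ((p * k)%:R - (z - (p * a)%:R)) ^+ 2.
Proof.
rewrite big_split_ord /=; congr (_ + _); apply: eq_bigr => k _.
by rewrite mulnDr natrD; congr (_ ^+ 2); ring.
Qed.

Lemma tsum_sum_type A B (o : A + B -> nat) (T : {ffun A + B -> nat} -> R) :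
  tsum p o T =
  \sum_(fA : {ffun A * A -> 'I_p.+1} | tournament fA)
  \sum_(fB : {ffun B * B -> 'I_p.+1} | tournament fB) \sum_(h : {ffun A * B -> 'I_p.+1})
  \sum_(gA : {ffun A * A -> 'I_p.+1} | tournament gA)
  \sum_(gB : {ffun B * B -> 'I_p.+1} | tournament gB) \sum_(h' : {ffun A * B -> 'I_p.+1})
    (if score (glue gA gB h') == score (glue fA fB h) then
       tweight R o (glue fA fB h) * tweight R o (glue gA gB h') * T (score (glue fA fB h)) else 0).
Proof.
rewrite /tsum big_tournament_sum; do 3 (apply: eq_bigr => ? _).
by rewrite big_mkcondr big_tournament_sum.
Qed.

Section Blocks.
Variables A B : finType.
Local Notation h0 := ([ffun => ord0] : {ffun A * B -> 'I_p.+1}).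

Definition renewal_blocks (m : {ffun A + B -> nat}) : bool :=
  [&& [forall a, m (inl a) < p * #|A|]%N, [forall b, p * #|A| <= m (inr b)]%N,
      (2 * \sum_a m (inl a) == p * (#|A| * #|A|.-1))%N & no_renewal_below #|A| m].

Lemma score_glue0_inl fA fB a : score (glue fA fB h0) (inl a) = score fA a.
Proof. by rewrite score_glue_inl big1 ?addn0// => b _; rewrite ffunE. Qed.

Lemma score_glue0_inr fA fB b : score (glue fA fB h0) (inr b) = (p * #|A| + score fB b)%N.
Proof.
rewrite score_glue_inr; congr (_ + _)%N.
by under eq_bigr => a _ do rewrite ffunE subn0; rewrite sum_nat_const mulnC.
Qed.

(** The games inside [A] already account for the whole sum [p a (a - 1) / 2], with [a = #|A|], so
    [A] wins no game against [B]. *)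
Lemma glue_cut0 fA fB (h : {ffun A * B -> 'I_p.+1}) : tournament fA ->
  (2 * \sum_a score (glue fA fB h) (inl a) == p * (#|A| * #|A|.-1))%N -> h = h0.
Proof.
move=> tA; under eq_bigr => a _ do rewrite score_glue_inl.
rewrite big_split /= mulnDr sum_score// -[X in _ == X]addn0 eqn_add2l muln_eq0 /=.
rewrite sum_nat_eq0 => /forallP h1; apply/ffunP => -[a b]; rewrite ffunE; apply/val_inj => /=.
by have /= := h1 a; rewrite sum_nat_eq0 => /forallP/(_ b)/eqP.
Qed.

Lemma score_glue0_eq fA fB gA gB :
  (score (glue gA gB h0) == score (glue fA fB h0)) = (score gA == score fA) && (score gB == score fB).
Proof.
apply/eqP/andP => [/ffunP e|[/eqP/ffunP eA /eqP/ffunP eB]].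
  split; apply/eqP/ffunP => x; first by have := e (inl x); rewrite !score_glue0_inl.
  by have := e (inr x); rewrite !score_glue0_inr => /addnI.
by apply/ffunP => -[a|b]; rewrite ?score_glue0_inl ?score_glue0_inr ?eA ?eB.
Qed.

Lemma renewal_at_glue0 fA fB k : (k < #|A|)%N ->
  renewal_at k (score (glue fA fB h0)) = renewal_at k (score fA).
Proof.
move=> kA; rewrite /renewal_at; congr (_ && _).
  congr (_ == _); rewrite big_sumType /= [X in (_ + X)%N]big_pred0 ?addn0.
    by apply: eq_bigl => a; rewrite score_glue0_inl.
  by move=> b; rewrite score_glue0_inr; apply/negbTE; rewrite -leqNgt (leq_trans _ (leq_addr _ _))// leq_mul2l ltnW ?orbT.
congr (2 * _ == _)%N; rewrite big_sumType /= [X in (_ + X)%N]big_pred0 ?addn0.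
  by apply: eq_big => a; rewrite score_glue0_inl.
by move=> b; rewrite score_glue0_inr; apply/negbTE; rewrite -leqNgt (leq_trans _ (leq_addr _ _))// leq_mul2l ltnW ?orbT.
Qed.

Lemma renewal_blocks_glue0 fA fB : (0 < p)%N -> tournament fA ->
  renewal_blocks (score (glue fA fB h0)) = no_renewal_below #|A| (score fA).
Proof.
move=> p0 tA; rewrite /renewal_blocks.
have -> : [forall a, score (glue fA fB h0) (inl a) < p * #|A|]%N.
  apply/forallP => a; rewrite score_glue0_inl (leq_ltn_trans (score_le a tA))//.
  by rewrite ltn_pmul2l// prednK//; apply/card_gt0P; exists a.
have -> : [forall b, p * #|A| <= score (glue fA fB h0) (inr b)]%N.
  by apply/forallP => b; rewrite score_glue0_inr leq_addr.
under eq_bigr => a _ do rewrite score_glue0_inl.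
rewrite sum_score// eqxx /=; apply: eq_forallb => k.
by rewrite renewal_at_glue0.
Qed.

(** Losing all cross games shifts the scores of [B] by [p * #|A|], as it does the reference
    exponents; [energy_shift] absorbs the shift. *)
Lemma gweight_glue0 fA fB : tournament fB ->
  gweight p theta (score (glue fA fB h0)) = gweight p theta (score fA) * gweight p theta (score fB).
Proof.
move=> tB; rewrite /gweight -expRD -mulrDr; congr (expR (_ * _)).
rewrite -[in RHS](@energy_shift _ _ B (score fB) (0 - (p * #|A|)%:R)) ?sum_score//.
rewrite /energy card_sum sum_base_add big_sumType /=.
under eq_bigr => a _ do rewrite score_glue0_inl.
under [X in _ + X - _ = _]eq_bigr => b _ do rewrite score_glue0_inr.
set X := \sum_(k < #|A|) _; set Y := \sum_(k < #|B|) _; set Z := \sum_(a : A) _.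
suff -> : \sum_(b : B) ((p * #|A| + score fB b)%:R - 0) ^+ 2 =
          \sum_(b : B) ((score fB b)%:R - (0 - (p * #|A|)%:R)) ^+ 2 :> R by ring.
by apply: eq_bigr => b _; rewrite natrD; congr (_ ^+ 2); ring.
Qed.

(** By [glue_cut0] both tournaments of a contributing pair have cross results [h0], whose weight is
    1. Equality of scores then splits into equality on [A] and on [B]. *)
Lemma tsum_renewal_blocks (o : A + B -> nat) : (0 < p)%N ->
  (forall a b, o (inl a) < o (inr b))%N ->
  tsum p o (fun m => gweight p theta m * (renewal_blocks m)%:R) =
  tsum p (o \o inl) (fun m => gweight p theta m * (no_renewal_below #|A| m)%:R) *
  tsum p (o \o inr) (@gweight _ p theta B).
Proof.
move=> p0 oAB; rewrite tsum_sum_type /tsum big_distrlr /=.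
apply: eq_bigr => fA tA; apply: eq_bigr => fB tB.
rewrite (bigD1 h0)//= [X in _ + X]big1 ?addr0; last first.
  move=> h hN; do 3 (rewrite big1// => ? _); case: ifP => // _.
  rewrite (_ : renewal_blocks _ = false) ?mulr0//; apply/negbTE; apply: contra hN.
  by move=> /and4P[_ _ e _]; apply/eqP/(glue_cut0 tA e).
rewrite big_distrlr /= big_mkcondr; apply: eq_bigr => gA tgA.
case: ifPn => [sA|sA]; last first.
  rewrite big1// => gB tgB; rewrite big1// => h _; case: ifPn => // /eqP e.
  case: (boolP (renewal_blocks (score (glue fA fB h0)))) => [/and4P[_ _ e1 _]|]; last by rewrite !mulr0.
  have hh : h = h0 by apply: (glue_cut0 tgA (fB := gB)); rewrite e.
  by move/eqP: e; rewrite hh score_glue0_eq (negPf sA).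
rewrite [RHS]big_mkcondr; apply: eq_bigr => gB tgB.
rewrite (bigD1 h0)//= [X in _ + X]big1 ?addr0; last first.
  move=> h hN; case: ifPn => // /eqP e.
  case: (boolP (renewal_blocks (score (glue fA fB h0)))) => [/and4P[_ _ e1 _]|]; last by rewrite !mulr0.
  have hh : h = h0 by apply: (glue_cut0 tgA (fB := gB)); rewrite e.
  by rewrite hh eqxx in hN.
rewrite score_glue0_eq sA /=; case: ifP => // _.
rewrite !tweight_glue// gweight_glue0// renewal_blocks_glue0//.
have -> : \prod_(x : A * B) ((-1) ^+ h0 x * 'C(p, h0 x)%:R) = 1 :> R.
  by rewrite big1// => x _; rewrite ffunE bin0 expr0 mul1r.
ring.
Qed.

End Blocks.

End Renewal.

Section SplitIndex.
Variables (I : finType) (S : pred I).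

Definition split_val (x : {i | S i} + {i | ~~ S i}) : I :=
  match x with inl u => val u | inr u => val u end.

Definition split_index (i : I) : {i | S i} + {i | ~~ S i} :=
  match boolP (S i) with
  | AltTrue h => inl (exist (fun i => S i) i h)
  | AltFalse h => inr (exist (fun i => ~~ S i) i h)
  end.

Lemma split_indexK : cancel split_index split_val.
Proof. by move=> i; rewrite /split_index; case: {-}_ / boolP. Qed.

Lemma split_valK : cancel split_val split_index.
Proof.
move=> x; have inj : injective split_val.
  move=> [[i hi]|[i hi]] [[j hj]|[j hj]] /= ij; try by congr (_ _); exact/val_inj.
  - by exfalso; move: hj; rewrite -ij hi.
  - by exfalso; move: hi; rewrite ij hj.
by apply: inj; rewrite split_indexK.
Qed.

End SplitIndex.

Section SumOrder.
Variables A B : finType.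

Definition sum_rank (x : A + B) : nat :=
  match x with inl a => enum_rank a | inr b => (#|A| + enum_rank b)%N end.

Lemma sum_rank_lt a b : (sum_rank (inl a) < sum_rank (inr b))%N.
Proof. by rewrite /= (leq_trans (ltn_ord _))// leq_addr. Qed.

Lemma sum_rank_inj : injective sum_rank.
Proof.
move=> [a|b] [a'|b'] /=.
- by move=> /val_inj/enum_rank_inj ->.
- by move=> e; have := sum_rank_lt a b'; rewrite /= e ltnn.
- by move=> e; have := sum_rank_lt a' b; rewrite /= e ltnn.
- by move=> /addnI/val_inj/enum_rank_inj ->.
Qed.

End SumOrder.

Section RenewalIdentity.
Context {R : realType}.
Variables (p : nat) (theta : R).
Implicit Types (I J A B : finType).

Section Relabel.
Variables (I J : finType) (phi : I -> J) (psi : J -> I).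
Hypotheses (phiK : cancel phi psi) (psiK : cancel psi phi).
Implicit Type m : {ffun I -> nat}.

Lemma card_relabel : #|J| = #|I|.
Proof. exact: (bij_eq_card (Bijective psiK phiK)). Qed.

Lemma big_relabel (S : Type) (idx : S) (op : Monoid.com_law idx) (P : pred nat) (F : nat -> S) m :
  \big[op/idx]_(j : J | P ([ffun j => m (psi j)] j)) F ([ffun j => m (psi j)] j) =
  \big[op/idx]_(i : I | P (m i)) F (m i).
Proof.
rewrite (reindex phi) /=; last by exists psi => ? _; rewrite ?phiK ?psiK.
by apply: eq_big => i; rewrite ffunE phiK.
Qed.

Lemma gweight_relabel m : gweight p theta ([ffun j => m (psi j)] : {ffun J -> nat}) = gweight p theta m.
Proof.
rewrite /gweight /energy card_relabel.
by rewrite (big_relabel _ xpredT (fun k => (k%:R - 0) ^+ 2)).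
Qed.

Lemma renewal_at_relabel k m :
  renewal_at p k ([ffun j => m (psi j)] : {ffun J -> nat}) = renewal_at p k m.
Proof.
by rewrite /renewal_at (big_relabel _ (fun a => a < p * k)%N (fun=> 1%N)) (big_relabel _ (fun a => a < p * k)%N id).
Qed.

Lemma no_renewal_relabel k m :
  no_renewal_below p k ([ffun j => m (psi j)] : {ffun J -> nat}) = no_renewal_below p k m.
Proof. by apply: eq_forallb => j; rewrite renewal_at_relabel. Qed.

End Relabel.

Lemma tsum_irr I (o : I -> nat) : injective o ->
  tsum p o (fun m => gweight p theta m * (no_renewal_below p #|I| m)%:R) =
  (#|I|)`!%:R * irr_weight p theta #|I|.
Proof.
move=> io; rewrite /irr_weight mulrC divfK ?pnatr_eq0 -?lt0n ?fact_gt0//.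
rewrite (tsum_relabel _ _ (@ord_inj _) io (@enum_valK I) (@enum_rankK I)).
apply: eq_tsum => f _.
by rewrite (gweight_relabel (@enum_valK I) (@enum_rankK I)) (no_renewal_relabel (@enum_valK I) (@enum_rankK I)).
Qed.

Definition first_renewal_set I k (S : {set I}) (m : {ffun I -> nat}) : bool :=
  [&& [forall i, (i \in S) == (m i < p * k)%N],
      (2 * \sum_(i in S) m i == p * (k * k.-1))%N & no_renewal_below p k m].

Lemma tsum_first_renewal_set I (o : I -> nat) (S : {set I}) : (0 < p)%N -> injective o ->
  tsum p o (fun m => gweight p theta m * (first_renewal_set #|S| S m)%:R) =
  (#|S|)`!%:R * irr_weight p theta #|S| * ((#|I| - #|S|)`!%:R * cc p theta (#|I| - #|S|)).
Proof.
move=> p0 io; pose P := mem S.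
have cA : #|{: {i | P i}}| = #|S| by rewrite card_sig.
have cB : #|{: {i | ~~ P i}}| = (#|I| - #|S|)%N.
  by rewrite card_sig -[#|I|](cardC P) addKn; apply: eq_card.
rewrite (tsum_relabel _ _ (@sum_rank_inj _ _) io (@split_valK I P) (@split_indexK I P)).
pose oA (a : {i | P i}) := sum_rank (inl a : {i | P i} + {i | ~~ P i}).
pose oB (b : {i | ~~ P i}) := sum_rank (inr b : {i | P i} + {i | ~~ P i}).
have ioA : injective oA by move=> ? ? /sum_rank_inj[].
have ioB : injective oB by move=> ? ? /sum_rank_inj[].
rewrite -cB -[in RHS]cA -(tsum_irr ioA) -(tsum_card p theta ioB).
rewrite -(tsum_renewal_blocks theta p0 (@sum_rank_lt _ _)).
apply: eq_tsum => f tf; set m := score f.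
rewrite (gweight_relabel (@split_valK I P) (@split_indexK I P)); congr (_ * _%:R).
rewrite /first_renewal_set (no_renewal_relabel (@split_valK I P) (@split_indexK I P)) /renewal_blocks cA.
congr (nat_of_bool _); rewrite [RHS]andbA; congr [&& _, _ & _].
- apply/forallP/andP => [h|[/forallP h1 /forallP h2] i].
    split; apply/forallP => -[i hi].
      have /eqP := h i; rewrite ffunE (_ : split_index P i = inl (exist _ i hi)).
        by move=> <-.
      by rewrite -[RHS]split_valK.
    have /eqP := h i; rewrite ffunE (_ : split_index P i = inr (exist _ i hi)).
      by move=> e; rewrite leqNgt -e.
    by rewrite -[RHS]split_valK.
  rewrite ffunE -{1}[i](@split_indexK I P); case: (split_index P i) => -[j hj] /=.
    by rewrite h1; exact/eqP.
  by rewrite ltnNge h2 /=; apply/eqP/negbTE.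
- congr (2 * _ == _)%N; rewrite (reindex (@split_val I P)) /=; last first.
    by exists (@split_index I P) => ? _; rewrite ?split_valK ?split_indexK.
  rewrite big_sumType /= [X in (_ + X)%N]big_pred0 ?addn0; last by case=> j hj /=; exact/negbTE.
  apply: eq_big => [[j hj]//|[j hj] _]; rewrite ffunE.
  by rewrite -[j in split_index _ j]/(split_val (inl (exist _ j hj))) split_valK.
Qed.

Lemma renewal_at_full I (f : {ffun I * I -> 'I_p.+1}) : (0 < p)%N -> tournament f ->
  renewal_at p #|I| (score f).
Proof.
move=> p0 tf.
have h i : (score f i < p * #|I|)%N.
  rewrite (leq_ltn_trans (score_le i tf))// ltn_pmul2l// prednK//.
  by apply/card_gt0P; exists i.
have e (F : I -> nat) : (\sum_(i | score f i < p * #|I|) F i = \sum_i F i)%N.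
  by apply: eq_bigl => i; rewrite h.
rewrite /renewal_at !e sum_score// eqxx andbT.
by rewrite sum1_card.
Qed.

Lemma sum_first_renewal_set I k (m : {ffun I -> nat}) :
  \sum_(S : {set I} | #|S| == k) (first_renewal_set k S m)%:R =
  (renewal_at p k m && no_renewal_below p k m)%:R :> R.
Proof.
pose S0 : {set I} := finset (fun i => (m i < p * k)%N).
have inS0 i : (i \in S0) = (m i < p * k)%N by rewrite inE.
have fS S : first_renewal_set k S m -> S = S0.
  by move=> /and3P[/forallP h _ _]; apply/setP => i; rewrite inS0; apply/eqP.
have E : first_renewal_set k S0 m = (2 * \sum_(i | (m i < p * k)%N) m i == p * (k * k.-1))%N && no_renewal_below p k m.
  rewrite /first_renewal_set (introT forallP) /=; last by move=> i; rewrite inS0.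
  by congr ((2 * _ == _)%N && _); apply: eq_bigl => i; rewrite inS0.
have cS0 : (\sum_(i | m i < p * k) 1)%N = #|S0| by rewrite -sum1_card; apply: eq_bigl => i; rewrite inS0.
have [c|c] := eqVneq #|S0| k.
  rewrite (bigD1 S0) /=; last exact/eqP.
  rewrite big1 ?addr0 => [|S /andP[_ SN]].
    by rewrite E /renewal_at cS0 c eqxx.
  by case: (boolP (first_renewal_set k S m)) => // /fS e; rewrite e eqxx in SN.
rewrite /renewal_at cS0 (negPf c) /= big1// => S /eqP cS.
by case: (boolP (first_renewal_set k S m)) => // /fS e; rewrite -e cS eqxx in c.
Qed.

Lemma sum_first_renewal I (f : {ffun I * I -> 'I_p.+1}) N : (0 < p)%N -> tournament f ->
  #|I| = N.+1 ->
  \sum_(k < N.+1) (renewal_at p k.+1 (score f) && no_renewal_below p k.+1 (score f))%:R = 1 :> R.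
Proof.
move=> p0 tf cI.
have ex : exists k, renewal_at p k.+1 (score f).
  by exists N; rewrite -cI; exact: renewal_at_full.
case: (ex_minnP ex) => k rk kmin.
have kN : (k < N.+1)%N by rewrite ltnS; apply: kmin; rewrite -cI; exact: renewal_at_full.
rewrite (bigD1 (Ordinal kN)) //= rk (_ : no_renewal_below _ _ _) /=; last first.
  apply/forallP => -[[|j] /= hj]; first by [].
  by apply/negP => rj; have := kmin j rj; lia.
rewrite big1 ?addr0// => j jN.
case: (boolP (renewal_at p j.+1 _)) => //= rj.
have kj : (k < j)%N.
  by rewrite ltn_neqAle kmin// andbT; apply: contra jN => /eqP e; apply/eqP/val_inj.
case: (boolP (no_renewal_below _ _ _)) => // /forallP.
have kj' : (k.+1 < j.+1)%N by [].
by move=> /(_ (Ordinal kj')) /=; rewrite rk.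
Qed.

(** Classify by the first renewal and by the set [S] of positions of the exponents below it. The
    binomial number of sets cancels the factorials of [tsum_first_renewal_set] against [N.+1]
    factorial. *)
Theorem cc_renewal N : (0 < p)%N ->
  cc p theta N.+1 = \sum_(k < N.+1) irr_weight p theta k.+1 * cc p theta (N - k).
Proof.
move=> p0; rewrite {1}/cc.
have E : tsum p (@nat_of_ord N.+1) (@gweight _ p theta 'I_N.+1) =
  tsum p (@nat_of_ord N.+1) (fun m => \sum_(k < N.+1) \sum_(S : {set 'I_N.+1} | #|S| == k.+1)
     gweight p theta m * (first_renewal_set k.+1 S m)%:R).
  apply: eq_tsum => f tf.
  rewrite -[LHS]mulr1 -[X in _ * X = _](sum_first_renewal p0 tf (card_ord _)) mulr_sumr.
  by apply: eq_bigr => k _; rewrite -sum_first_renewal_set mulr_sumr.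
rewrite E tsum_sum mulr_suml; apply: eq_bigr => k _.
rewrite tsum_sum.
under eq_bigr => S /eqP cS.
  rewrite -cS tsum_first_renewal_set ?cS//; last exact: ord_inj.
  over.
rewrite sumr_const (_ : #|_| = 'C(N.+1, k.+1)); last first.
  by rewrite -[X in 'C(X, _)]card_ord -card_draws; apply: eq_card => S; rewrite !inE.
rewrite card_ord subSS -[X in X / _]mulr_natl.
have kN : (k.+1 <= N.+1)%N by [].
have -> : (N.+1)`!%:R = 'C(N.+1, k.+1)%:R * ((k.+1)`!%:R * (N - k)`!%:R) :> R.
  by rewrite -2!natrM -(bin_fact kN) subSS.
have := fact_gt0 k.+1; have := fact_gt0 (N - k); have : (0 < 'C(N.+1, k.+1))%N by rewrite bin_gt0.
rewrite -!(ltr0n R); move: ('C(_, _)%:R : R) ((k.+1)`!%:R : R) ((N - k)`!%:R : R) => a b c a0 c0 b0.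
by field; rewrite !gt_eqF.
Qed.

End RenewalIdentity.

(** * Decoupling at an overcrowded window *)

Section CauchySchwarz.
Context {R : realType} {T : finType}.
Variable P : pred T.

Lemma sum_cauchy_schwarz (W z : T -> R) : (forall i, 0 <= W i) ->
  (\sum_(i | P i) W i * z i) ^+ 2 <= (\sum_(i | P i) W i) * (\sum_(i | P i) W i * z i ^+ 2).
Proof.
move=> W0; set A := \sum_(i | P i) W i * z i; set B := \sum_(i | P i) W i.
set C := \sum_(i | P i) W i * z i ^+ 2.
have : 0 <= \sum_(i | P i) \sum_(j | P j) W i * W j * (z i - z j) ^+ 2.
  by apply: sumr_ge0 => i _; apply: sumr_ge0 => j _; rewrite mulr_ge0 ?sqr_ge0// mulr_ge0.
have -> : \sum_(i | P i) \sum_(j | P j) W i * W j * (z i - z j) ^+ 2 = 2 * (B * C - A ^+ 2).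
  transitivity (\sum_(i | P i) (W i * z i ^+ 2 * B - 2 * (W i * z i * A) + W i * C)).
    apply: eq_bigr => i _; rewrite /A /B /C !mulr_sumr -sumrB -big_split /=.
    by apply: eq_bigr => j _; ring.
  rewrite big_split /= sumrB -!mulr_suml -!mulr_sumr -mulr_suml -/A -/B -/C; ring.
lra.
Qed.

(** [om] will be the coupling weight at a fixed configuration: it makes the first factor bounded,
    and its inverse is compensated by the Gaussian weight in the second. *)
Lemma sum_cauchy_schwarz_weighted (w om y : T -> R) : (forall i, 0 < om i) ->
  (\sum_(i | P i) w i * y i) ^+ 2 <=
  (\sum_(i | P i) `|w i| * om i) * (\sum_(i | P i) `|w i| / om i * y i ^+ 2).
Proof.
move=> om0.
apply: (@le_trans _ _ ((\sum_(i | P i) `|w i| * om i * (`|y i| / om i)) ^+ 2)).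
  rewrite -[leLHS]real_normK ?num_real// lerXn2r ?nnegrE ?normr_ge0//.
    by apply: sumr_ge0 => i _; rewrite mulr_ge0 ?divr_ge0 ?mulr_ge0// ltW.
  apply: le_trans (ler_norm_sum _ _ _) _; apply: ler_sum => i _.
  suff -> : `|w i| * om i * (`|y i| / om i) = `|w i * y i| by [].
  by rewrite normrM; move: `|w i| `|y i| => a b; field; exact: lt0r_neq0.
apply: le_trans (sum_cauchy_schwarz _ _) _.
  by move=> i; rewrite mulr_ge0// ltW.
rewrite le_eqVlt; apply/orP; left; apply/eqP; congr (_ * _); apply: eq_bigr => i _.
rewrite exprMn real_normK ?num_real//; move: `|w i| => a; field; exact: lt0r_neq0.
Qed.

End CauchySchwarz.

Section ThreeBlocks.
Context {R : realType}.
Variables (p : nat) (theta : R) (L M Q : finType).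
Hypothesis theta_gt0 : 0 < theta.
Local Notation I := (L + (M + Q))%type.
Local Notation game X Y := {ffun X * Y -> 'I_p.+1}.

(* Results of all games between players that are neither both in [L] nor both in [Q]. *)
Definition cut := (game M M * (game M Q * game L (M + Q)))%type.
Implicit Type k : cut.

(** [cut_out] counts games won by [l] against [M] and [Q], and [cut_in] games lost by [q] to [L] and
    [M]: both count the results that go against the order [L], [M], [Q]. *)
Definition cut_out k (l : L) : nat := \sum_x k.2.2 (l, x).
Definition cut_in k (q : Q) : nat := (\sum_l k.2.2 (l, inr q) + \sum_i k.2.1 (i, q))%N.
Definition cut_mid k (i : M) : nat :=
  (\sum_l (p - k.2.2 (l, inl i)) + (score k.1 i + \sum_q k.2.1 (i, q)))%N.

Definition cut_weight k : R :=
  tweight R (@sum_rank M Q \o inl) k.1 *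
  (\prod_(x : M * Q) ((-1) ^+ k.2.1 x * 'C(p, k.2.1 x)%:R)) *
  (\prod_(x : L * (M + Q)) ((-1) ^+ k.2.2 x * 'C(p, k.2.2 x)%:R)).

Definition rank3 (x : I) : nat :=
  match x with inl l => enum_rank l | inr y => (#|L| + sum_rank y)%N end.

Lemma rank3_lt a b : (rank3 (inl a) < rank3 (inr b))%N.
Proof. by rewrite /= (leq_trans (ltn_ord _))// leq_addr. Qed.

Lemma rank3_inj : injective rank3.
Proof.
move=> [a|b] [a'|b'] /=.
- by move=> /val_inj/enum_rank_inj ->.
- by move=> e; have := rank3_lt a b'; rewrite /= e ltnn.
- by move=> e; have := rank3_lt a' b; rewrite /= e ltnn.
- by move=> /addnI/sum_rank_inj ->.
Qed.

Definition glue3 (fL : game L L) k (fQ : game Q Q) : game I I :=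
  glue fL (glue k.1 fQ k.2.1) k.2.2.

Lemma tweight_glue3 fL k fQ :
  tweight R rank3 (glue3 fL k fQ) =
  cut_weight k * (tweight R enum_rank fL * tweight R (@sum_rank M Q \o inr) fQ).
Proof.
rewrite /glue3 tweight_glue//; last exact: rank3_lt.
have -> : tweight R (rank3 \o inr) (glue k.1 fQ k.2.1) = tweight R (@sum_rank M Q) (glue k.1 fQ k.2.1).
  by apply: eq_bigl => x /=; rewrite ltn_add2l.
rewrite tweight_glue; last exact: sum_rank_lt.
rewrite /cut_weight; set a := tweight _ _ _; set b := tweight _ _ _; set c := tweight _ _ _.
by set d := \prod_(x : M * Q) _; set e := \prod_(x : L * _) _; ring.
Qed.

(* [u] and [v] are the scores inside [L] and inside [Q]. *)
Definition cut_match k (u : {ffun L -> nat}) (v : {ffun Q -> nat}) (m : {ffun I -> nat}) : bool :=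
  [&& [forall l, m (inl l) == u l + cut_out k l]%N, [forall i, m (inr (inl i)) == cut_mid k i] &
      [forall q, m (inr (inr q)) + cut_in k q == p * (#|L| + #|M|) + v q]%N].

Lemma score_glue3 fL k fQ m :
  (score (glue3 fL k fQ) == m) = cut_match k (score fL) (score fQ) m.
Proof.
have s1 l : score (glue3 fL k fQ) (inl l) = (score fL l + cut_out k l)%N.
  exact: score_glue_inl.
have s2 i : score (glue3 fL k fQ) (inr (inl i)) = cut_mid k i.
  by rewrite score_glue_inr score_glue_inl.
have sumB (X : finType) (F : X -> 'I_p.+1) : (\sum_x (p - F x) + \sum_x F x = p * #|X|)%N.
  rewrite -big_split /= mulnC -sum_nat_const; apply: eq_bigr => x _.
  by rewrite subnK// -ltnS.
have s3 q : (score (glue3 fL k fQ) (inr (inr q)) + cut_in k q = p * (#|L| + #|M|) + score fQ q)%N.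
  rewrite score_glue_inr score_glue_inr /cut_in.
  have := sumB _ (fun l => k.2.2 (l, inr q)); have := sumB _ (fun i => k.2.1 (i, q)).
  rewrite mulnDr => <- <-; ring.
apply/eqP/and3P => [<-|[/forallP h1 /forallP h2 /forallP h3]].
  by split; apply/forallP => x; rewrite ?s1 ?s2 ?s3.
apply/ffunP => -[l|[i|q]].
- by rewrite s1; apply/esym/eqP.
- by rewrite s2; apply/esym/eqP.
- by apply/eqP; rewrite -(eqn_add2r (cut_in k q)) s3 eq_sym.
Qed.

Lemma coef_sum (X : finType) (o : X -> nat) (G : {ffun X -> nat} -> R) B : (#|X| * p < B.+1)%N ->
  \sum_(u : {ffun X -> 'I_B.+1}) G (natf u) * coef p o (natf u) =
  \sum_(f : game X X | tournament f) G (score f) * tweight R o f.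
Proof.
move=> hB.
rewrite [RHS](partition_big (fun f => [ffun i => inord (score f i) : 'I_B.+1]) xpredT) //=.
apply: eq_bigr => m _; rewrite mulr_sumr; apply: eq_big => [f|f /andP[tf /eqP <-]//].
by congr (_ && _); rewrite -(inj_eq (@natf_inj _ _)) natf_score.
Qed.

(** Group the tournaments by the results [k] of the cut and by the inner scores; the inner sums are
    the coefficients of the uncoupled parts. *)
Lemma coef_cut B (m : {ffun I -> nat}) : (#|L| * p < B.+1)%N -> (#|Q| * p < B.+1)%N ->
  coef p rank3 m = \sum_(k | tournament k.1) \sum_(u : {ffun L -> 'I_B.+1}) \sum_(v : {ffun Q -> 'I_B.+1})
    if cut_match k (natf u) (natf v) m then
      cut_weight k * (coef p enum_rank (natf u) * coef p (@sum_rank M Q \o inr) (natf v)) else 0 :> R.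
Proof.
move=> hL hQ; rewrite {1}/coef big_mkcondr big_tournament_sum.
transitivity (\sum_(k | tournament k.1) \sum_(fL : game L L | tournament fL) \sum_(fQ : game Q Q | tournament fQ)
   if score (glue3 fL k fQ) == m then tweight R rank3 (glue3 fL k fQ) else 0).
  rewrite [RHS]exchange_big; apply: eq_bigr => fL tL.
  rewrite exchange_big /=.
  under eq_bigr => h _ do rewrite big_tournament_sum.
  rewrite exchange_big /=.
  transitivity (\sum_(fM : game M M | tournament fM) \sum_(hh : game M Q * game L (M + Q)) \sum_(fQ : game Q Q | tournament fQ)
     if score (glue3 fL (fM, hh) fQ) == m then tweight R rank3 (glue3 fL (fM, hh) fQ) else 0).
    apply: eq_bigr => fM tM; rewrite exchange_big /= [RHS]exchange_big; apply: eq_bigr => fQ tQ.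
    by rewrite exchange_big pair_bigA /=; apply: eq_bigr => -[].
  by rewrite pair_big_dep /=; apply: eq_big => -[fM hh] //=; rewrite andbT.
apply: eq_bigr => k tk.
transitivity (\sum_(fL : game L L | tournament fL)
   (\sum_(v : {ffun Q -> 'I_B.+1}) (if cut_match k (score fL) (natf v) m then cut_weight k else 0) * coef p (@sum_rank M Q \o inr) (natf v))
   * tweight R enum_rank fL).
  apply: eq_bigr => fL tL.
  rewrite (coef_sum _ (fun s => if cut_match k (score fL) s m then cut_weight k else 0) hQ) mulr_suml.
  apply: eq_bigr => fQ tQ; rewrite score_glue3 tweight_glue3; case: ifP => _; last by rewrite !mul0r.
  by rewrite mulrA [LHS]mulrAC.
rewrite -(coef_sum _ (fun s => \sum_(v : {ffun Q -> 'I_B.+1}) (if cut_match k s (natf v) m then cut_weight k else 0) * coef p (@sum_rank M Q \o inr) (natf v)) hL).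
apply: eq_bigr => u _; rewrite mulr_suml; apply: eq_bigr => v _.
by case: ifP => _; rewrite ?mul0r// -mulrA [X in _ * X]mulrC.
Qed.

Lemma expR_binom (t : R) : 0 <= t -> \sum_(e < p.+1) 'C(p, e)%:R * t ^+ e <= expR (p%:R * t).
Proof.
move=> t0; rewrite (_ : \sum_(e < _) _ = (1 + t) ^+ p).
  by rewrite expRM_natl lerXn2r ?nnegrE ?expR_ge0 ?addr_ge0// expR_ge1Dx.
by rewrite exprDn; apply: eq_bigr => e _; rewrite expr1n mul1r mulr_natl.
Qed.

Lemma game_sum_le (X Y : finType) (t : X * Y -> R) : (forall x, 0 <= t x) ->
  \sum_(h : game X Y) \prod_x ('C(p, h x)%:R * t x ^+ h x) <= expR (p%:R * \sum_x t x).
Proof.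
move=> t0; rewrite -(bigA_distr_bigA (fun x e => 'C(p, nat_of_ord e)%:R * t x ^+ e)).
rewrite mulr_sumr expR_sum; apply: ler_prod => x _.
by rewrite expR_binom// andbT sumr_ge0// => e _; rewrite mulr_ge0// exprn_ge0.
Qed.

Lemma norm_cut_weight k : `|cut_weight k| =
  (\prod_(x : M * M | (sum_rank (inl x.1 : M + Q) < sum_rank (inl x.2 : M + Q))%N) 'C(p, k.1 x)%:R) *
  (\prod_(x : M * Q) 'C(p, k.2.1 x)%:R) * (\prod_(x : L * (M + Q)) 'C(p, k.2.2 x)%:R).
Proof.
have e n : `|(-1) ^+ n| = 1 :> R by rewrite normrX normrN1 expr1n.
rewrite /cut_weight !normrM /tweight !normr_prod.
by congr (_ * _ * _); apply: eq_bigr => x _; rewrite normrM e mul1r normr_nat.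
Qed.

(** The sum factorizes over pairs of players. A pair of weight [t] gives [(1 + t)^p <= exp (p t)],
    with [t] equal to [1] inside [M], [y l] or [y' q] against [M], and [y l * y' q] across. Adding
    the exponents gives the square. *)
Lemma cut_sum_le (S : R) (y : L -> R) (y' : Q -> R) :
  (forall l, 0 <= y l) -> (forall q, 0 <= y' q) ->
  \sum_l y l <= S -> \sum_q y' q <= S ->
  \sum_(k | tournament k.1) `|cut_weight k| *
     ((\prod_l y l ^+ cut_out k l) * (\prod_q y' q ^+ cut_in k q)) <=
  expR (p%:R * (#|M|%:R + S) ^+ 2).
Proof.
move=> y0 y'0 yS y'S.
pose t (x : L * (M + Q)) := y x.1 * (match x.2 with inl _ => 1 | inr q => y' q end).
pose t' (x : M * Q) := y' x.2.
have t0 x : 0 <= t x by rewrite /t mulr_ge0//; case: x.2.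
have t'0 x : 0 <= t' x by rewrite /t'.
have E k : (\prod_l y l ^+ cut_out k l) * (\prod_q y' q ^+ cut_in k q) =
   (\prod_x t' x ^+ k.2.1 x) * (\prod_x t x ^+ k.2.2 x).
  have -> : \prod_l y l ^+ cut_out k l = \prod_(x : L * (M + Q)) y x.1 ^+ k.2.2 x.
    under eq_bigr => l _ do rewrite /cut_out -prodrXr.
    by rewrite pair_bigA /=; apply: eq_bigr => -[].
  have -> : \prod_q y' q ^+ cut_in k q =
     (\prod_(x : L * Q) y' x.2 ^+ k.2.2 (x.1, inr x.2)) * \prod_x t' x ^+ k.2.1 x.
    under eq_bigr => q _ do rewrite /cut_in exprD -!prodrXr.
    rewrite big_split /= exchange_big pair_bigA /= exchange_big pair_bigA /=; congr (_ * _).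
    by apply: eq_bigr => -[].
  rewrite mulrCA mulrA [RHS]mulrC; congr (_ * _).
  under [RHS]eq_bigr => x _ do rewrite /t exprMn.
  rewrite [RHS]big_split /= [RHS]mulrC; congr (_ * _).
  rewrite -(pair_bigA _ (fun l q => y' q ^+ k.2.2 (l, inr q))) /=.
  transitivity (\prod_l \prod_(z : M + Q) (match z with inl _ => 1 | inr q => y' q end) ^+ k.2.2 (l, z)); last first.
    by rewrite pair_bigA /=; apply: eq_bigr => -[].
  apply: eq_bigr => l _; rewrite big_sumType /= [X in X * _]big1 ?mul1r// => i _.
  by rewrite expr1n.
under eq_bigr => k _ do rewrite norm_cut_weight E.
pose GM := \sum_(f : game M M | tournament f) \prod_(x : M * M | (sum_rank (inl x.1 : M + Q) < sum_rank (inl x.2 : M + Q))%N) 'C(p, f x)%:R : R.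
pose GQ := \sum_(h : game M Q) \prod_x ('C(p, h x)%:R * t' x ^+ h x).
pose GL := \sum_(h : game L (M + Q)) \prod_x ('C(p, h x)%:R * t x ^+ h x).
have -> : \sum_(k : cut | tournament k.1) (\prod_(x : M * M | (sum_rank (inl x.1 : M + Q) < sum_rank (inl x.2 : M + Q))%N) 'C(p, k.1 x)%:R) *
  (\prod_(x : M * Q) 'C(p, k.2.1 x)%:R) * (\prod_(x : L * (M + Q)) 'C(p, k.2.2 x)%:R) *
  ((\prod_x t' x ^+ k.2.1 x) * (\prod_x t x ^+ k.2.2 x)) = GM * (GQ * GL).
  rewrite /GQ big_distrlr /= pair_bigA /= /GM big_distrlr /= pair_big_dep /=.
  apply: eq_big => -[f [h h']] /=; first by rewrite andbT.
  move=> _; rewrite !big_split /=; ring.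
have GMle : GM <= expR (p%:R * #|M|%:R ^+ 2).
  have io : injective (fun i : M => sum_rank (inl i : M + Q)) by move=> a b /sum_rank_inj[].
  rewrite /GM (tournament_distr io (fun x (e : 'I_p.+1) => 'C(p, e)%:R : R)).
  apply: (@le_trans _ _ (\prod_(x : M * M) expR (p%:R * 1))).
    rewrite big_mkcond /=; apply: ler_prod => x _.
    have h := @expR_binom 1 ler01.
    case: ifP => _; last by rewrite ler01 /= mulr1 -expR0 ler_expR.
    apply/andP; split; first exact: sumr_ge0.
    by apply: le_trans h; apply: ler_sum => e _; rewrite expr1n mulr1.
  by rewrite prodr_const -expRM_natl card_prod natrM expr2 mulr1 mulrC.
have GQle : GQ <= expR (p%:R * (#|M|%:R * S)).
  apply: le_trans (game_sum_le t'0) _; rewrite ler_expR ler_wpM2l//.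
  rewrite -(pair_bigA _ (fun i q => y' q)) /= sumr_const -[leLHS]mulr_natl ler_wpM2l//.
have GLle : GL <= expR (p%:R * (S * #|M|%:R + S * S)).
  apply: le_trans (game_sum_le t0) _; rewrite ler_expR ler_wpM2l//.
  rewrite -(pair_bigA _ (fun l x => y l * (match x with inl _ => 1 | inr q => y' q end))) /=.
  under eq_bigr => l _ do rewrite -mulr_sumr big_sumType /= sumr_const.
  rewrite -mulr_suml -mulrDr; apply: ler_pM => //; first exact: sumr_ge0.
    by rewrite addr_ge0// sumr_ge0.
  by rewrite lerD2l.
have G0 : 0 <= GM /\ 0 <= GQ /\ 0 <= GL.
  split; first by apply: sumr_ge0 => f _; apply: prodr_ge0.
  by split; apply: sumr_ge0 => f _; apply: prodr_ge0 => x _; rewrite mulr_ge0// exprn_ge0.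
case: G0 => GM0 [GQ0 GL0].
apply: (@le_trans _ _ (expR (p%:R * #|M|%:R ^+ 2) * (expR (p%:R * (#|M|%:R * S)) * expR (p%:R * (S * #|M|%:R + S * S))))).
  by rewrite ler_pM ?mulr_ge0// ler_pM.
by rewrite -!expRD ler_expR -!mulrDr ler_wpM2l//; lra.
Qed.

Lemma sum_bool_le1 (T : finType) (b : pred T) :
  (forall x y, b x -> b y -> x = y) -> \sum_x (b x)%:R <= 1 :> R.
Proof.
move=> ub; have [/existsP[x bx]|/existsPn nb] := boolP [exists x, b x].
  rewrite (bigD1 x)//= bx big1 ?addr0// => y yx.
  by case: (boolP (b y)) => // by_; rewrite (ub _ _ by_ bx) eqxx in yx.
by rewrite big1 ?ler01// => x _; rewrite (negPf (nb x)).
Qed.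

(** The second moment about [z] exceeds the one about the mean, which is the left side. *)
Lemma sum_base_ge n (z : R) :
  p%:R ^+ 2 * n%:R * (n%:R ^+ 2 - 1) / 12 <= \sum_(k < n) ((p * k)%:R - z) ^+ 2.
Proof.
have -> : \sum_(k < n) ((p * k)%:R - z) ^+ 2 =
    p%:R ^+ 2 * n%:R * (n%:R ^+ 2 - 1) / 12 + n%:R * (z - p%:R * (n%:R - 1) / 2) ^+ 2.
  elim: n => [|n IH]; first by rewrite big_ord0; field.
  by rewrite big_ord_recr /= IH natrM -natr1; field.
by rewrite lerDl mulr_ge0 ?sqr_ge0.
Qed.

Lemma cut_match_inj_m k u v m m' : cut_match k u v m -> cut_match k u v m' -> m = m'.
Proof.
move=> /and3P[/forallP h1 /forallP h2 /forallP h3] /and3P[/forallP g1 /forallP g2 /forallP g3].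
apply/ffunP => -[l|[i|q]].
- by rewrite (eqP (h1 l)) (eqP (g1 l)).
- by rewrite (eqP (h2 i)) (eqP (g2 i)).
- by apply/eqP; rewrite -(eqn_add2r (cut_in k q)) (eqP (h3 q)) (eqP (g3 q)).
Qed.

Lemma cut_match_inj_uv k u v u' v' m : cut_match k u v m -> cut_match k u' v' m -> u = u' /\ v = v'.
Proof.
move=> /and3P[/forallP h1 _ /forallP h3] /and3P[/forallP g1 _ /forallP g3].
split; apply/ffunP => x.
- by apply/eqP; rewrite -(eqn_add2r (cut_out k x)) -(eqP (h1 x)) -(eqP (g1 x)).
- by apply/eqP; rewrite -(eqn_add2l (p * (#|L| + #|M|))) -(eqP (h3 x)) -(eqP (g3 x)).
Qed.

Definition balanced (X : finType) (m : {ffun X -> nat}) : Prop :=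
  (2 * \sum_i m i = p * (#|X| * #|X|.-1))%N.

(* Only [L] and [Q] are compared with their uncoupled exponents; all terms are taken relative
   to the common point [z], which is possible because the total degree is fixed. *)
Lemma energy_cut k u v m (z : R) : cut_match k u v m ->
  balanced u -> balanced v -> balanced m ->
  energy p m 0 = energy p u 0 + energy p v 0
    + \sum_l (cut_out k l)%:R * ((m (inl l))%:R + (u l)%:R - 2 * z)
    - \sum_q (cut_in k q)%:R * ((m (inr (inr q)))%:R + (p * (#|L| + #|M|) + v q)%:R - 2 * z)
    + (\sum_i ((m (inr (inl i)))%:R - z) ^+ 2
       - \sum_(j < #|M|) ((p * j)%:R - (z - (p * #|L|)%:R)) ^+ 2).
Proof.
move=> /and3P[/forallP h1 /forallP h2 /forallP h3] bu bv bm.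
rewrite -(energy_shift z bm) -(energy_shift z bu).
rewrite -(energy_shift (z - (p * #|L|)%:R - (p * #|M|)%:R) bv) /energy.
rewrite !card_sum !sum_base_add !big_sumType /=.
set b1 := \sum_(j < #|L|) _; set b2 := \sum_(j < #|M|) _; set b3 := \sum_(j < #|Q|) _.
set s2 := \sum_(i : M) _.
have -> : \sum_(l : L) ((m (inl l))%:R - z) ^+ 2 = \sum_(l : L) ((u l)%:R - z) ^+ 2
   + \sum_l (cut_out k l)%:R * ((m (inl l))%:R + (u l)%:R - 2 * z).
  rewrite -big_split /=; apply: eq_bigr => l _; rewrite (eqP (h1 l)) natrD; ring.
have -> : \sum_(q : Q) ((m (inr (inr q)))%:R - z) ^+ 2 =
   \sum_(q : Q) ((v q)%:R - (z - (p * #|L|)%:R - (p * #|M|)%:R)) ^+ 2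
   - \sum_q (cut_in k q)%:R * ((m (inr (inr q)))%:R + (p * (#|L| + #|M|) + v q)%:R - 2 * z).
  rewrite -sumrB /=; apply: eq_bigr => q _.
  have e : (m (inr (inr q)))%:R = (p * (#|L| + #|M|) + v q)%:R - (cut_in k q)%:R :> R.
    by rewrite -(eqP (h3 q)) natrD addrK.
  rewrite e !natrD !natrM natrD; ring.
ring.
Qed.

(** [M] is the window. With spacing [p] its exponents would need radius about [p * #|M| / 2], so the
    first condition requires about twice that density. The last two make the coupling to the outer
    blocks summable. *)
Definition piled_up (S : R) (m : {ffun I -> nat}) : Prop :=
  exists z h : nat, [/\ (4 * h <= p * #|M|)%N,
    forall i, `|(m (inr (inl i)))%:R - z%:R| <= h%:R :> R,
    \sum_l expR (theta * ((m (inl l))%:R - z%:R)) <= S &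
    \sum_q expR (theta * (z%:R - (m (inr (inr q)))%:R)) <= S].

Definition cut_power (y : L -> R) (y' : Q -> R) k : R :=
  (\prod_l y l ^+ cut_out k l) * (\prod_q y' q ^+ cut_in k q).

(** The first term is [n * (p n / 4)^2], from the radius of the window; the second is the least
    reference moment of [sum_base_ge]. The cubic part is [- theta p^2 n^3 / 48]. *)
Definition mid_cost (n : nat) : R :=
  theta * (p%:R ^+ 2 * n%:R ^+ 3 / 16 - p%:R ^+ 2 * n%:R * (n%:R ^+ 2 - 1) / 12).

(* These weights bound [expR (theta * (u l - z))] uniformly in the point [z] of [piled_up],
   which depends on the whole configuration. *)
Definition softL (S : R) (u : {ffun L -> nat}) (l : L) : R :=
  S * expR (theta * (u l)%:R) / \sum_j expR (theta * (u j)%:R).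

Definition softQ (S : R) (v : {ffun Q -> nat}) (q : Q) : R :=
  S * expR (- (theta * (p * (#|L| + #|M|) + v q)%:R)) /
  \sum_j expR (- (theta * (p * (#|L| + #|M|) + v j)%:R)).

Lemma soft_sum_le (X : finType) (S : R) (F : X -> R) : 0 <= S -> (forall x, 0 < F x) ->
  \sum_x (S * F x / \sum_j F j) <= S.
Proof.
move=> S0 F0; rewrite -mulr_suml -mulr_sumr.
have [->|N0] := eqVneq (\sum_j F j) 0; first by rewrite mulr0 mul0r.
by rewrite mulfK.
Qed.

(** In [energy_cut] each [cut_out k l] multiplies [(m l - z) + (u l - z)]. The first half is divided
    out on the left; the second is bounded by the soft weights, which do not involve [z]. The same
    is done for [Q]. *)
Lemma gweight_cut (S : R) k u v m (z h : nat) : 0 <= S -> cut_match k u v m ->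
  balanced u -> balanced v -> balanced m ->
  (4 * h <= p * #|M|)%N ->
  (forall i, `|(m (inr (inl i)))%:R - z%:R| <= h%:R :> R) ->
  \sum_l expR (theta * ((m (inl l))%:R - z%:R)) <= S ->
  \sum_q expR (theta * (z%:R - (m (inr (inr q)))%:R)) <= S ->
  gweight p theta m / cut_power (fun l => expR (theta * ((m (inl l))%:R - z%:R)))
     (fun q => expR (theta * (z%:R - (m (inr (inr q)))%:R))) k <=
  expR (mid_cost #|M|) * (gweight p theta u * gweight p theta v) * cut_power (softL S u) (softQ S v) k.
Proof.
move=> S0 mt bu bv bm hh hM hL hQ.
have [/forallP h1 _ /forallP h3] := and3P mt.
have powE (X : finType) (F : X -> R) (n : X -> nat) : \prod_x expR (F x) ^+ n x = expR (\sum_x (n x)%:R * F x).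
  by rewrite expR_sum; apply: eq_bigr => x _; rewrite expRM_natl.
(* [u <= m] on [L] gives [\sum_j expR (theta * (u j - z)) <= S], that is, [expR (- theta * z) <= S /
   \sum_j expR (theta * u j)]. On [Q] the inequality between inner and full exponents is
   reversed. *)
have lo_le : expR (\sum_l (cut_out k l)%:R * (theta * ((u l)%:R - z%:R)) +
    \sum_q (cut_in k q)%:R * (theta * (z%:R - (p * (#|L| + #|M|) + v q)%:R))) <= cut_power (softL S u) (softQ S v) k.
  rewrite expRD -!powE /cut_power; apply: ler_pM; try by apply: prodr_ge0 => x _; rewrite exprn_ge0// expR_ge0.
    apply: ler_prod => l _; rewrite exprn_ge0 ?expR_ge0//= lerXn2r ?nnegrE ?expR_ge0//.
      by rewrite /softL divr_ge0 ?mulr_ge0 ?expR_ge0// sumr_ge0// => j _; exact: expR_ge0.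
    rewrite /softL ler_pdivlMr; last first.
      by rewrite (bigD1 l)//= ltr_wpDr ?expR_gt0// sumr_ge0// => j _; exact: expR_ge0.
    rewrite mulrBr expRD -mulrA mulrC ler_wpM2r ?expR_ge0//.
    apply: le_trans hL; rewrite mulr_sumr; apply: ler_sum => j _.
    rewrite -expRD ler_expR addrC -mulrBr ler_pM2l// lerD2r ler_nat.
    by rewrite (eqP (h1 j)) leq_addr.
  apply: ler_prod => q _; rewrite exprn_ge0 ?expR_ge0//= lerXn2r ?nnegrE ?expR_ge0//.
    by rewrite /softQ divr_ge0 ?mulr_ge0 ?expR_ge0// sumr_ge0// => j _; exact: expR_ge0.
  rewrite /softQ ler_pdivlMr; last first.
    by rewrite (bigD1 q)//= ltr_wpDr ?expR_gt0// sumr_ge0// => j _; exact: expR_ge0.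
  rewrite mulrBr expRD mulrAC ler_wpM2r ?expR_ge0//.
  apply: le_trans hQ; rewrite mulr_sumr; apply: ler_sum => j _.
  rewrite -expRD ler_expR -mulrBr ler_pM2l// lerB// ler_nat.
  by rewrite -(eqP (h3 j)) leq_addr.
have midle : theta * (\sum_i ((m (inr (inl i)))%:R - z%:R) ^+ 2
       - \sum_(j < #|M|) ((p * j)%:R - (z%:R - (p * #|L|)%:R)) ^+ 2) <= mid_cost #|M|.
  rewrite /mid_cost ler_pM2l//; apply: lerB; last exact: sum_base_ge.
  apply: (@le_trans _ _ (\sum_(i : M) h%:R ^+ 2)).
    by apply: ler_sum => i _; rewrite -real_normK ?num_real// lerXn2r ?nnegrE.
  rewrite sumr_const -[leLHS]mulr_natl.
  have hh' : h%:R <= p%:R * #|M|%:R / 4 :> R.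
    by rewrite ler_pdivlMr// -!natrM ler_nat mulnC.
  have -> : p%:R ^+ 2 * #|M|%:R ^+ 3 / 16 = #|M|%:R * (p%:R * #|M|%:R / 4) ^+ 2 :> R by field.
  by rewrite ler_wpM2l// lerXn2r// nnegrE// divr_ge0// mulr_ge0.
apply: (@le_trans _ _ (expR (mid_cost #|M|) * (gweight p theta u * gweight p theta v) *
   expR (\sum_l (cut_out k l)%:R * (theta * ((u l)%:R - z%:R)) +
    \sum_q (cut_in k q)%:R * (theta * (z%:R - (p * (#|L| + #|M|) + v q)%:R))))); last first.
  by rewrite ler_wpM2l// ?mulr_ge0 ?expR_ge0.
rewrite /cut_power !powE -expRD -expRN /gweight -!expRD ler_expR.
rewrite (energy_cut z%:R mt bu bv bm).
set s1 := \sum_l (cut_out k l)%:R * ((m (inl l))%:R + (u l)%:R - _).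
set s2 := \sum_q (cut_in k q)%:R * ((m (inr (inr q)))%:R + _ - _).
set a1 := \sum_l (cut_out k l)%:R * (theta * ((m _)%:R - _)).
set a2 := \sum_q (cut_in k q)%:R * (theta * (_ - (m _)%:R)).
set c1 := \sum_l (cut_out k l)%:R * (theta * ((u _)%:R - _)).
set c2 := \sum_q (cut_in k q)%:R * (theta * (_ - (_ + v _)%:R)).
have e1 : theta * s1 = a1 + c1.
  by rewrite /s1 /a1 /c1 mulr_sumr -big_split /=; apply: eq_bigr => l _; ring.
have e2 : theta * s2 = - (a2 + c2).
  by rewrite /s2 /a2 /c2 mulr_sumr -big_split -sumrN /=; apply: eq_bigr => l _; ring.
move: midle; set mm := _ - \sum_(j < _) _ => midle.
have -> : theta * (energy p u 0 + energy p v 0 + s1 - s2 + mm) =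
   theta * energy p u 0 + theta * energy p v 0 + theta * s1 - theta * s2 + theta * mm by ring.
rewrite e1 e2; lra.
Qed.

Lemma coef_balanced (X : finType) (o : X -> nat) (m : {ffun X -> nat}) :
  coef p o m != 0 :> R -> balanced m.
Proof.
rewrite /coef => nz.
have [/existsP[f /andP[tf /eqP <-]]|/existsPn nf] :=
    boolP [exists f : game X X, tournament f && (score f == m)]; first exact: sum_score.
by rewrite big_pred0 ?eqxx// in nz => f; exact/negbTE.
Qed.

Let gw0 (X : finType) (m : {ffun X -> nat}) : 0 <= gweight p theta m.
Proof. exact/ltW/gweight_gt0. Qed.

(** For fixed [m], Cauchy-Schwarz over [(k, u, v)] bounds the squared coefficient, with first factor
    at most [E]. After exchanging sums, [(k, u, v)] determines [m], and the soft weights give a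
    second factor [E]; [D] comes from the window. *)
Theorem tsum_piled_up (S : R) : 0 <= S ->
  tsum p rank3 (fun m => gweight p theta m * `[< piled_up S m >]%:R) <=
  expR (2 * p%:R * (#|M|%:R + S) ^+ 2 + mid_cost #|M|) *
  (tsum p (fun l : L => enum_rank l) (@gweight _ p theta L) *
   tsum p (@sum_rank M Q \o inr) (@gweight _ p theta Q)).
Proof.
move=> S0; pose B := (#|{: I}| * p)%N.
have hI : (#|{: I}| * p < B.+1)%N by [].
have hL : (#|L| * p < B.+1)%N by rewrite ltnS leq_mul2r card_sum leq_addr orbT.
have hQ : (#|Q| * p < B.+1)%N by rewrite ltnS leq_mul2r !card_sum addnA leq_addl orbT.
rewrite (tsum_coef _ _ hI) (tsum_coef _ _ hL) (tsum_coef _ _ hQ).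
pose X := (cut * ({ffun L -> 'I_B.+1} * {ffun Q -> 'I_B.+1}))%type.
pose a (t : X) : R := coef p (fun l : L => enum_rank l) (natf t.2.1).
pose b (t : X) : R := coef p (@sum_rank M Q \o inr) (natf t.2.2).
pose mt (t : X) (m : {ffun I -> 'I_B.+1}) := cut_match t.1 (natf t.2.1) (natf t.2.2) (natf m).
pose E := expR (p%:R * (#|M|%:R + S) ^+ 2).
pose D := expR (mid_cost #|M|).
pose G (t : X) := `|cut_weight t.1| * cut_power (softL S (natf t.2.1)) (softQ S (natf t.2.2)) t.1 *
   (gweight p theta (natf t.2.1) * a t ^+ 2 * (gweight p theta (natf t.2.2) * b t ^+ 2)).
have softL0 u l : 0 <= softL S u l.
  by rewrite /softL divr_ge0 ?mulr_ge0 ?expR_ge0// sumr_ge0// => j _; exact: expR_ge0.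
have softQ0 v q : 0 <= softQ S v q.
  by rewrite /softQ divr_ge0 ?mulr_ge0 ?expR_ge0// sumr_ge0// => j _; exact: expR_ge0.
have G0 t : 0 <= G t.
  have c0 : 0 <= cut_power (softL S (natf t.2.1)) (softQ S (natf t.2.2)) t.1.
    by rewrite /cut_power mulr_ge0// prodr_ge0// => x _; rewrite exprn_ge0.
  by rewrite /G; apply: mulr_ge0; apply: mulr_ge0; rewrite // mulr_ge0 ?sqr_ge0 ?gw0.
have sumX (F : X -> R) : \sum_(t : X | tournament t.1.1) F t =
    \sum_(k : cut | tournament k.1) \sum_(uv : {ffun L -> 'I_B.+1} * {ffun Q -> 'I_B.+1}) F (k, uv).
  by rewrite pair_big_dep /=; apply: eq_big => -[k uv] //=; rewrite andbT.
have coefE (m : {ffun I -> 'I_B.+1}) : coef p rank3 (natf m) =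
   \sum_(t : X | tournament t.1.1 && mt t m) cut_weight t.1 * (a t * b t).
  rewrite (coef_cut _ hL hQ) /X.
  rewrite (eq_bigr (fun k => \sum_(uv : {ffun L -> 'I_B.+1} * {ffun Q -> 'I_B.+1})
     if mt (k, uv) m then cut_weight k * (a (k, uv) * b (k, uv)) else 0)); last first.
    by move=> k _; rewrite pair_bigA; apply: eq_bigr => -[].
  by rewrite pair_big_dep /= [RHS]big_mkcondr /=; apply: eq_big => -[k uv] //=; rewrite andbT.
have termle (m : {ffun I -> 'I_B.+1}) :
    gweight p theta (natf m) * `[< piled_up S (natf m) >]%:R * coef p rank3 (natf m) ^+ 2 <=
    E * D * \sum_(t : X | tournament t.1.1 && mt t m) G t.
  have [[z [h [hh hM hLS hQS]]]|nP] := pselect (piled_up S (natf m)); last first.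
    rewrite (_ : `[< _ >] = false) ?mulr0 ?mul0r; last exact/asboolPn.
    by rewrite !mulr_ge0 ?expR_ge0// sumr_ge0.
  rewrite (_ : `[< _ >] = true) ?mulr1; last first.
    by apply/asboolP; exists z, h.
  set y := fun l => expR (theta * ((natf m (inl l))%:R - z%:R)).
  set y' := fun q => expR (theta * (z%:R - (natf m (inr (inr q)))%:R)).
  have om0 (t : X) : 0 < cut_power y y' t.1.
    by rewrite /cut_power mulr_gt0// prodr_gt0// => x _; rewrite exprn_gt0// expR_gt0.
  rewrite coefE.
  have := sum_cauchy_schwarz_weighted (fun t : X => tournament t.1.1 && mt t m) (fun t => cut_weight t.1) (fun t => a t * b t) om0.
  set Z1 := \sum_(t | _) _ * _ => cs.
  (* Given [m], the results [k] leave at most one pair [(u, v)], so this is a sum over [k] alone. *)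
  have F1 : \sum_(t : X | tournament t.1.1 && mt t m) `|cut_weight t.1| * cut_power y y' t.1 <= E.
    apply: le_trans (cut_sum_le (y := y) (y' := y') _ _ hLS hQS); last 2 first.
    - by move=> l; exact: expR_ge0.
    - by move=> q; exact: expR_ge0.
    rewrite big_mkcondr /= sumX /=.
    apply: ler_sum => k tk.
    rewrite (eq_bigr (fun uv => (`|cut_weight k| * cut_power y y' k) * (mt (k, uv) m)%:R)); last first.
      by move=> uv _; case: ifP; rewrite ?mulr1 ?mulr0.
    rewrite -mulr_sumr ler_piMr//; first by rewrite mulr_ge0// ltW// (om0 (k, ([ffun=> ord0], [ffun=> ord0]))).
    apply: sum_bool_le1 => -[u v] [u' v'] m1 m2.
    by have [/natf_inj /= -> /natf_inj /= ->] := cut_match_inj_uv m1 m2.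
  apply: (@le_trans _ _ (gweight p theta (natf m) * (E * \sum_(t : X | tournament t.1.1 && mt t m) `|cut_weight t.1| / cut_power y y' t.1 * (a t * b t) ^+ 2))).
    rewrite ler_wpM2l ?gw0//; apply: le_trans cs _.
    rewrite ler_wpM2r// sumr_ge0// => t _; rewrite mulr_ge0 ?sqr_ge0// divr_ge0// ltW//.
  rewrite mulrCA -mulrA ler_wpM2l ?expR_ge0// !mulr_sumr; apply: ler_sum => t /andP[tt mtt].
  (* A nonzero coefficient comes from an actual tournament, which provides the degree identities
     required by [gweight_cut]. *)
  have [->|a0] := eqVneq (a t) 0.
    by rewrite mul0r expr0n !mulr0 /= mulr_ge0 ?expR_ge0.
  have [->|b0] := eqVneq (b t) 0.
    by rewrite mulr0 expr0n !mulr0 /= mulr_ge0 ?expR_ge0.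
  have bu := coef_balanced a0; have bv := coef_balanced b0.
  have [fL tL sL] : exists2 f : game L L, tournament f & score f = natf t.2.1.
    apply/exists2P; apply: contrapT => nex; move/negP: a0; apply; apply/eqP.
    rewrite /a /coef big_pred0// => f; apply/negbTE/negP => /andP[tf /eqP sf]; apply: nex.
    by exists f.
  have [fQ tQ sQ] : exists2 f : game Q Q, tournament f & score f = natf t.2.2.
    apply/exists2P; apply: contrapT => nex; move/negP: b0; apply; apply/eqP.
    rewrite /b /coef big_pred0// => f; apply/negbTE/negP => /andP[tf /eqP sf]; apply: nex.
    by exists f.
  have bm : balanced (natf m).
    have := mtt; rewrite /mt -sL -sQ -score_glue3 => /eqP <-; apply: sum_score.
    by rewrite !tournament_glue tL tQ tt.
  have := gweight_cut S0 mtt bu bv bm hh hM hLS hQS; rewrite -/y -/y' => gc.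
  rewrite /G.
  have -> : gweight p theta (natf m) * (`|cut_weight t.1| / cut_power y y' t.1 * (a t * b t) ^+ 2) =
     gweight p theta (natf m) / cut_power y y' t.1 * (`|cut_weight t.1| * (a t * b t) ^+ 2) by ring.
  have -> : D * (`|cut_weight t.1| * cut_power (softL S (natf t.2.1)) (softQ S (natf t.2.2)) t.1 *
     (gweight p theta (natf t.2.1) * a t ^+ 2 * (gweight p theta (natf t.2.2) * b t ^+ 2))) =
    D * (gweight p theta (natf t.2.1) * gweight p theta (natf t.2.2)) * cut_power (softL S (natf t.2.1)) (softQ S (natf t.2.2)) t.1 * (`|cut_weight t.1| * (a t * b t) ^+ 2) by ring.
  by rewrite ler_wpM2r// mulr_ge0 ?sqr_ge0.
apply: le_trans (ler_sum _ (fun m _ => termle m)) _.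
rewrite -mulr_sumr.
have -> : expR (2 * p%:R * (#|M|%:R + S) ^+ 2 + mid_cost #|M|) = E * D * E.
  by rewrite /E /D -!expRD; congr expR; ring.
rewrite -[leRHS]mulrA ler_wpM2l ?mulr_ge0 ?expR_ge0//.
(* [G] does not depend on [m], and each [t] matches at most one [m]. *)
apply: (@le_trans _ _ (\sum_(t : X | tournament t.1.1) G t)).
  rewrite (eq_bigr (fun m => \sum_(t : X | tournament t.1.1) G t * (mt t m)%:R)); last first.
    by move=> m _; rewrite big_mkcondr; apply: eq_bigr => t _; case: ifP; rewrite ?mulr1 ?mulr0.
  rewrite exchange_big /=; apply: ler_sum => t _; rewrite -mulr_sumr ler_piMr//.
  apply: sum_bool_le1 => m m' m1 m2; apply: natf_inj; exact: cut_match_inj_m m1 m2.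
rewrite sumX exchange_big /= big_distrlr /= pair_bigA /= mulr_sumr; apply: ler_sum => -[u v] _ /=.
rewrite /G /a /b /= -mulr_suml ler_wpM2r//; last first.
  by apply: (cut_sum_le (softL0 _) (softQ0 _)); apply: soft_sum_le => // x; exact: expR_gt0.
by rewrite mulr_ge0// mulr_ge0 ?sqr_ge0 ?gw0.
Qed.

End ThreeBlocks.

Lemma big_sig_val (S : Type) (idx : S) (op : Monoid.com_law idx) (I : finType) (P : pred I) (F : I -> S) :
  \big[op/idx]_(u : {i | P i}) F (val u) = \big[op/idx]_(i | P i) F i.
Proof.
rewrite [RHS](reindex (@split_val I P)) /=; last first.
  by exists (@split_index I P) => ? _; rewrite ?split_valK ?split_indexK.
rewrite big_sumType /= [X in op _ X]big_pred0 ?Monoid.mulm1; last by case=> j hj /=; exact/negbTE.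
by apply: eq_bigl => -[j hj] /=.
Qed.

(** * Choice of the window and quasi-submultiplicativity *)

Section PileChoice.
Context {R : realType}.
Variables (p : nat) (theta : R).
Hypotheses (p_gt0 : (0 < p)%N) (theta_gt0 : 0 < theta).

(** The factor [4 t + 2] will bound the number of exponents within distance [t] of the window's
    center. *)
Lemma linear_geometric_bound :
  exists2 S : R, 0 <= S & forall T, \sum_(t < T) (4 * t + 2)%:R * expR (- (theta * t%:R)) <= S.
Proof.
pose x := expR (- (theta / 2)).
have x0 : 0 < x by exact: expR_gt0.
have x1 : x < 1 by rewrite /x expR_lt1 oppr_lt0 divr_gt0.
have C0 : 0 <= 8 / theta + 2 by rewrite addr_ge0// divr_ge0// ltW.
exists ((8 / theta + 2) / (1 - x)); first by rewrite divr_ge0// subr_ge0 ltW.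
move=> T; apply: (@le_trans _ _ (\sum_(t < T) (8 / theta + 2) * x ^+ t)).
  apply: ler_sum => t _.
  (* Half of the decay absorbs the linear factor, through [1 + s <= exp s]; the other half is summed
     as a geometric series. *)
  have -> : expR (- (theta * t%:R)) = x ^+ t * x ^+ t.
    by rewrite /x -!expRM_natl -expRD; congr expR; field.
  rewrite mulrA ler_wpM2r//; first by rewrite exprn_ge0// ltW.
  have h : x ^+ t * (1 + theta / 2 * t%:R) <= 1.
    rewrite /x -expRM_natl mulrN expRN mulrC ler_pdivrMr ?expR_gt0// mul1r.
    by apply: le_trans (expR_ge1Dx _) _; rewrite ler_expR mulrC.
  have xt0 : 0 <= x ^+ t by rewrite exprn_ge0// ltW.
  have xt1 : x ^+ t <= 1 by rewrite exprn_ile1 ?ltW.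
  have -> : (4 * t + 2)%:R * x ^+ t = 8 / theta * (x ^+ t * (theta / 2 * t%:R)) + 2 * x ^+ t.
    by rewrite natrD natrM; field; exact: lt0r_neq0.
  have h2 : 8 / theta * (x ^+ t * (theta / 2 * t%:R)) <= 8 / theta.
    rewrite -[leRHS]mulr1 ler_wpM2l ?divr_ge0 ?(ltW theta_gt0)//.
    by apply: le_trans h; rewrite mulrDr mulr1 lerDr.
  by move: h2 xt1; lra.
rewrite -mulr_sumr ler_wpM2l//.
have : (1 - x) * \sum_(t < T) x ^+ t <= 1.
  have := subrX1 x T; have : 0 <= x ^+ T by rewrite exprn_ge0// ltW.
  by move=> h0 h1; move: h0 h1; set s := \sum_(i < T) _; lra.
by rewrite mulrC -ler_pdivlMr ?subr_gt0// mul1r.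
Qed.

Variable I : finType.
Implicit Type m : {ffun I -> nat}.

Let sum1_sub (P Q : pred I) : (forall i, P i -> Q i) -> (\sum_(i | P i) 1 <= \sum_(i | Q i) 1)%N.
Proof.
move=> h; rewrite big_mkcond [leqRHS]big_mkcond; apply: leq_sum => i _.
by case: ifP => // /h ->.
Qed.

Let cnt m z h := (\sum_(i | (z <= m i + h) && (m i <= z + h)) 1)%N.

Let cnt_le m z h : (cnt m z h <= #|I|)%N.
Proof. by rewrite /cnt sum1_card max_card. Qed.

(* [z] is the [n]-th smallest exponent and [h] the largest radius at which the window around
   [z] is overcrowded. *)
Lemma pile_choice (S : R) m n n' : (#|I| = n + n')%N ->
  (forall T, \sum_(t < T) (4 * t + 2)%:R * expR (- (theta * t%:R)) <= S) ->
  exists z h : nat,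
  [/\ (\sum_(i | m i + h < z) 1 <= n)%N, (\sum_(i | z + h < m i) 1 <= n')%N,
      (4 * h <= p * \sum_(i | (z <= m i + h) && (m i <= z + h)) 1)%N,
      \sum_(i | (m i + h < z)%N) expR (theta * ((m i)%:R - z%:R)) <= S &
      \sum_(i | (z + h < m i)%N) expR (theta * (z%:R - (m i)%:R)) <= S].
Proof.
move=> cI hS.
have exz : exists c, (n <= \sum_(i | m i <= c) 1)%N.
  exists (\sum_i m i)%N; rewrite (eq_bigl xpredT) ?sum1_card ?cI ?leq_addr// => i.
  by rewrite (bigD1 i)//= leq_addr.
case: (ex_minnP exz) => z hz zmin.
pose P h := (h == 0)%N || (2 * (2 * h + 1) <= p * cnt m z h)%N.
have exh : exists h, P h by exists 0%N.
have hb h : P h -> (h <= p * #|I|)%N.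
  move=> /orP[/eqP->//|hh]; have := leq_mul (leqnn p) (cnt_le m z h); lia.
case: (ex_maxnP exh hb) => h Ph hmax.
have cbig t : (h < t)%N -> (cnt m z t <= 4 * t + 2)%N.
  move=> ht; rewrite leqNgt; apply/negP => ct.
  have : P t.
    apply/orP; right; apply: (@leq_trans (cnt m z t)); first lia.
    by rewrite leq_pmull.
  by move=> /hmax; lia.
(* The exponents at distance exactly [t] are counted crudely by the whole window of radius [t]. *)
have layer t (Q : pred I) : (h < t)%N -> (forall i, Q i -> (z <= m i + t) && (m i <= z + t))%N ->
    \sum_(i | Q i) expR (- (theta * t%:R)) <= (4 * t + 2)%:R * expR (- (theta * t%:R)).
  move=> ht hQ; rewrite sumr_const -[leLHS]mulr_natl ler_wpM2r ?expR_ge0// ler_nat.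
  by apply: leq_trans (cbig t ht); rewrite -sum1_card; exact: sum1_sub.
exists z, h; split.
- apply: (@leq_trans (\sum_(i | m i < z) 1)%N).
    apply: sum1_sub => i; lia.
  case: z hz zmin {P exh hb Ph hmax cbig layer} => [|z] hz zmin.
    by rewrite big_pred0.
  by rewrite leqNgt; apply/negP => hn; have := zmin z (ltnW hn); rewrite ltnn.
(* At least [n] exponents are at most [z], which leaves at most [n'] above it. *)
- have : (\sum_(i | m i <= z) 1 + \sum_(i | z + h < m i) 1 <= n + n')%N.
    have e : (#|I| = \sum_(i | m i <= z) 1 + \sum_(i | ~~ (m i <= z)) 1)%N.
      by rewrite -sum1_card (bigID (fun i => m i <= z)%N).
    rewrite -cI e leq_add2l.
    apply: sum1_sub => i; lia.
  by move: hz; lia.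
- by move: Ph => /orP[/eqP ->//|]; rewrite /cnt; lia.
- rewrite (partition_big (fun i => inord (z - m i) : 'I_z.+1) xpredT) //=.
  apply: le_trans (hS z.+1); apply: ler_sum => t _.
  have E i : ((m i + h < z) && (inord (z - m i) == t :> 'I_z.+1))%N -> (m i + t = z)%N /\ (h < t)%N.
    move=> /andP[h1 /eqP <-]; rewrite inordK; lia.
  rewrite (eq_bigr (fun=> expR (- (theta * t%:R)))); last first.
    move=> i /E[e _]; congr expR; have := congr1 (fun a => a%:R : R) e.
    by rewrite natrD; move: (nat_of_ord t) => s; nra.
  have [ht|ht] := ltnP h t; first by apply: layer => // i /E[]; lia.
  rewrite big_pred0 ?mulr_ge0 ?expR_ge0// => i; apply/negbTE/negP => /E[_]; lia.
- pose X := (\sum_i m i)%N.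
  have mX i : (m i <= X)%N by rewrite /X (bigD1 i)//= leq_addr.
  rewrite (partition_big (fun i => inord (m i - z) : 'I_X.+1) xpredT) //=.
  apply: le_trans (hS X.+1); apply: ler_sum => t _.
  have E i : ((z + h < m i) && (inord (m i - z) == t :> 'I_X.+1))%N -> (z + t = m i)%N /\ (h < t)%N.
    move=> /andP[h1 /eqP <-]; rewrite inordK; have := mX i; lia.
  rewrite (eq_bigr (fun=> expR (- (theta * t%:R)))); last first.
    move=> i /E[e _]; congr expR; rewrite -e natrD; ring.
  have [ht|ht] := ltnP h t; first by apply: layer => // i /E[]; lia.
  rewrite big_pred0 ?mulr_ge0 ?expR_ge0// => i; apply/negbTE/negP => /E[_]; lia.
Qed.

End PileChoice.

(** * The cases of at most one particle and of [p = 0] *)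

Section TrivialTournaments.
Context {R : realType}.
Variables (p : nat) (theta : R).

Lemma tsum_unique (I : finType) (o : I -> nat) (T : {ffun I -> nat} -> R) :
  (forall f : {ffun I * I -> 'I_p.+1}, tournament f = (f == [ffun => ord0])) ->
  tsum p o T = T [ffun => 0%N].
Proof.
move=> tE; rewrite /tsum (eq_bigl _ _ tE) big_pred1_eq.
rewrite (eq_bigl (fun g => g == [ffun => ord0])); last first.
  by move=> g; rewrite tE; case: eqP => // ->; rewrite eqxx.
rewrite big_pred1_eq.
have -> : tweight R o ([ffun => ord0] : {ffun I * I -> 'I_p.+1}) = 1.
  by rewrite /tweight big1// => x _; rewrite ffunE bin0 expr0 mul1r.
rewrite !mul1r; congr T; apply/ffunP => i; rewrite !ffunE big1// => j _.
by rewrite ffunE.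
Qed.

Lemma cc_le1 N : (N <= 1)%N -> cc p theta N = 1.
Proof.
move=> N1; rewrite /cc tsum_unique.
  rewrite /gweight /energy card_ord; case: N N1 => [|[|//]] _.
    by rewrite !big_ord0 subrr mulr0 expR0 fact0 divr1.
  by rewrite !big_ord1 ffunE muln0 subrr mulr0 expR0 divr1.
move=> f; apply/idP/eqP => [tf|->].
  apply/ffunP => -[i j]; rewrite ffunE; apply/val_inj => /=.
  have -> : i = j by apply/val_inj => /=; case: i j N1 {tf f} => [i hi] [j hj] /= ; lia.
  exact: tournament_diag.
apply/tournamentP; split=> [i|i j]; rewrite ?ffunE// => ij; exfalso; move/negP: ij; apply.
by apply/eqP/val_inj => /=; case: i j N1 => [i hi] [j hj] /= ; lia.
Qed.

End TrivialTournaments.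

Lemma cc_p0 {R : realType} (theta : R) N : cc 0 theta N = (N`!%:R)^-1.
Proof.
rewrite /cc tsum_unique.
  rewrite /gweight /energy !big1 ?subrr ?mulr0 ?expR0 ?mul1r//.
  - by move=> k _; rewrite subrr expr0n.
  - by move=> k _; rewrite ffunE subrr expr0n.
move=> f; apply/idP/eqP => [_|->].
  by apply/ffunP => x; rewrite ffunE; apply/val_inj => /=; case: (f x) => -[].
by apply/tournamentP; split=> [i|i j _]; rewrite !ffunE.
Qed.

Section Submultiplicative.
Context {R : realType}.
Variables (p : nat) (theta : R).
Hypotheses (p_gt0 : (0 < p)%N) (theta_gt0 : 0 < theta).

Lemma irr_weight1 : irr_weight p theta 1 = 1.
Proof.
have := cc_renewal theta 0 p_gt0; rewrite big_ord1 subnn !cc_le1// mulr1 => <-//.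
Qed.

Lemma cc_homo n n' : (n <= n')%N -> cc p theta n <= cc p theta n'.
Proof.
elim: n' => [|n' IH]; first by rewrite leqn0 => /eqP ->.
rewrite leq_eqVlt => /orP[/eqP ->//|/IH h]; apply: le_trans h _.
rewrite cc_renewal// big_ord_recl /= irr_weight1 mul1r subn0 lerDl sumr_ge0// => k _.
by rewrite mulr_ge0 ?irr_weight_ge0 ?cc_ge0.
Qed.

Lemma cc_ge1 n : 1 <= cc p theta n.
Proof. by rewrite -(@cc_le1 _ p theta 0)// cc_homo. Qed.

(** The negative cubic term of [mid_cost] outweighs the quadratic coupling cost, uniformly in the
    window size. *)
Lemma block_cost_bound (S : R) : 0 <= S ->
  exists2 G : R, 0 <= G & forall n : nat, expR (2 * p%:R * (n%:R + S) ^+ 2 + mid_cost p theta n) <= G.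
Proof.
(* [1/12 - 1/16 = 1/48]. The linear part of [mid_cost] is [4 * al * n], which goes into [B]; beyond
   [X] the cubic term dominates the others. *)
move=> S0; pose al := theta * p%:R ^+ 2 / 48.
have p0 : 0 < p%:R :> R by rewrite ltr0n.
have al0 : 0 < al by rewrite /al divr_gt0// mulr_gt0// exprn_gt0.
pose A := 2 * p%:R : R; pose B := 4 * p%:R * S + 4 * al; pose C := 2 * p%:R * S ^+ 2.
have A0 : 0 <= A by rewrite /A mulr_ge0// ltW.
have B0 : 0 <= B by rewrite /B addr_ge0// mulr_ge0// ?mulr_ge0// ltW.
pose X := 1 + (A + B) / al.
have X0 : 0 <= (A + B) / al by apply: divr_ge0; [exact: addr_ge0|exact: ltW].
exists (expR (A * X ^+ 2 + B * X + C)); first exact: expR_ge0.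
move=> n; rewrite ler_expR.
have -> : 2 * p%:R * (n%:R + S) ^+ 2 + mid_cost p theta n =
   A * n%:R ^+ 2 + B * n%:R + C - al * n%:R ^+ 3.
  by rewrite /mid_cost /A /B /C /al; field.
have n0 : 0 <= n%:R :> R by [].
move: (n%:R : R) n0 => x x0.
have [xX|Xx] := leP x X.
  have h3 : 0 <= al * x ^+ 3 by rewrite mulr_ge0 ?exprn_ge0// ltW.
  have h2 : A * x ^+ 2 <= A * X ^+ 2.
    by rewrite ler_wpM2l// lerXn2r// nnegrE /X addr_ge0.
  have h1 : B * x <= B * X by rewrite ler_wpM2l.
  lra.
have x1 : 1 <= x by move: Xx; rewrite /X; lra.
have hx : A + B <= al * x.
  rewrite mulrC -ler_pdivrMr//; move: Xx; rewrite /X; lra.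
have h1 : (A + B) * x ^+ 2 <= al * x ^+ 3.
  by rewrite [x ^+ 3]exprS mulrA ler_wpM2r ?sqr_ge0.
have h2 : B * x <= B * x ^+ 2 by rewrite ler_wpM2l// expr2 ler_peMl.
have h3 : 0 <= A * X ^+ 2 + B * X.
  by rewrite addr_ge0// mulr_ge0 ?sqr_ge0// /X addr_ge0.
lra.
Qed.

Section Piles.
Variables (I : finType) (S : R).
Hypothesis S_ge0 : 0 <= S.
Hypothesis hS : forall T, \sum_(t < T) (4 * t + 2)%:R * expR (- (theta * t%:R)) <= S.

(** [piled_up] for subsets of one index type, with the complement of [A :|: B] as window, so that a
    union bound over [A] and [B] is possible. *)
Definition pile_sets (A B : {set I}) (m : {ffun I -> nat}) : Prop :=
  exists z h : nat, [/\ (4 * h <= p * #|~: (A :|: B)|)%N,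
    forall i, i \notin A :|: B -> `|(m i)%:R - z%:R| <= h%:R :> R,
    \sum_(i in A) expR (theta * ((m i)%:R - z%:R)) <= S &
    \sum_(i in B) expR (theta * (z%:R - (m i)%:R)) <= S].

Lemma pile_sets_exist m n n' : (#|I| = n + n')%N ->
  exists A B : {set I}, [/\ B \subset ~: A, (#|A| <= n)%N, (#|B| <= n')%N & pile_sets A B m].
Proof.
move=> cI; have [z [h [hA hB hM SA SB]]] := pile_choice p_gt0 theta_gt0 m cI hS.
pose A : {set I} := finset (fun i => (m i + h < z)%N).
pose B : {set I} := finset (fun i => (z + h < m i)%N).
have iA i : (i \in A) = (m i + h < z)%N by rewrite inE.
have iB i : (i \in B) = (z + h < m i)%N by rewrite inE.
have iM i : (i \in ~: (A :|: B)) = (z <= m i + h)%N && (m i <= z + h)%N.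
  by rewrite !inE; lia.
exists A, B; split.
- by apply/fintype.subsetP => i; rewrite finset.in_setC iA iB; lia.
- by rewrite -sum1_card (eq_bigl _ _ iA).
- by rewrite -sum1_card (eq_bigl _ _ iB).
exists z, h; split.
- by rewrite -sum1_card (eq_bigl _ _ iM).
- move=> i; rewrite -finset.in_setC iM => /andP[h1 h2].
  move: h1 h2; rewrite -!(ler_nat R) !natrD ler_norml => h1 h2.
  by apply/andP; split; lra.
- by rewrite (eq_bigl _ _ iA).
- by rewrite (eq_bigl _ _ iB).
Qed.

Lemma tsum_pile_sets (o : I -> nat) (A B : {set I}) : injective o -> B \subset ~: A ->
  tsum p o (fun m => gweight p theta m * `[< pile_sets A B m >]%:R) <=
  expR (2 * p%:R * (#|~: (A :|: B)|%:R + S) ^+ 2 + mid_cost p theta #|~: (A :|: B)|) *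
  ((#|A|)`!%:R * cc p theta #|A| * ((#|B|)`!%:R * cc p theta #|B|)).
Proof.
move=> io dAB; pose C := ~: (A :|: B).
pose L := {i | i \in A}; pose M := {i | i \in C}; pose Q := {i | i \in B}.
pose phi (x : L + (M + Q)) : I := match x with inl l => val l | inr (inl i) => val i | inr (inr q) => val q end.
have cL : #|{: L}| = #|A| by rewrite card_sig.
have cM : #|{: M}| = #|C| by rewrite card_sig.
have cQ : #|{: Q}| = #|B| by rewrite card_sig.
have inC i : i \in C -> (i \notin A) && (i \notin B) by rewrite !inE negb_or.
have AB i : i \in A -> i \in B -> False.
  by move=> iA /(fintype.subsetP dAB); rewrite finset.in_setC iA.
have phi_inj : injective phi.
  move=> [[l hl]|[[i hi]|[q hq]]] [[l' hl']|[[i' hi']|[q' hq']]] /= e;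
    try (by congr inl; exact/val_inj); try (by congr (inr (inl _)); exact/val_inj);
    try (by congr (inr (inr _)); exact/val_inj); exfalso.
  - by move: (inC _ hi'); rewrite -e hl.
  - by apply: (AB l) => //; rewrite e.
  - by move: (inC _ hi); rewrite e hl'.
  - by move: (inC _ hi); rewrite e hq' andbF.
  - by apply: (AB l') => //; rewrite -e.
  - by move: (inC _ hi'); rewrite -e hq andbF.
have [psi phiK psiK] : bijective phi.
  apply: inj_card_bij => //; rewrite !card_sum cL cM cQ addnCA -[#|I|](cardsC (A :|: B)) -/C addnC.
  by rewrite leq_add2l (leq_card_setU A B).
rewrite (tsum_relabel _ _ (@rank3_inj L M Q) io phiK psiK).
apply: le_trans.
  apply: (@ler_tsum _ _ _ _ _ (fun m => gweight p theta m * `[< piled_up p theta S m >]%:R)) => f tf.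
  rewrite (gweight_relabel _ _ phiK psiK) ler_wpM2l ?(ltW (gweight_gt0 _ _ _))// ler_nat.
  case: asboolP => // -[z [h [h1 h2 h3 h4]]]; case: asboolP => // -[].
  exists z, h; split.
  - by rewrite cM.
  - move=> [i hi]; have := h2 i; rewrite ffunE.
    rewrite -[i in psi i]/(phi (inr (inl (exist _ i hi)))) phiK; apply.
    by have := hi; rewrite /C finset.in_setC.
  - apply: le_trans h3; rewrite -[leRHS]big_sig_val /=; apply: ler_sum => -[i hi] _.
    by rewrite ffunE -[val _]/(phi (inl (exist _ i hi))) phiK.
  - apply: le_trans h4; rewrite -[leRHS]big_sig_val /=; apply: ler_sum => -[i hi] _.
    by rewrite ffunE -[val _]/(phi (inr (inr (exist _ i hi)))) phiK.
apply: le_trans (tsum_piled_up p L M Q theta_gt0 S_ge0) _.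
rewrite !tsum_card ?cL ?cM ?cQ//.
- by move=> a b /sum_rank_inj[].
- by move=> a b /val_inj/enum_rank_inj.
Qed.

End Piles.

Lemma sum_inv_fact_le4 n : \sum_(i < n) (i`!%:R)^-1 <= 4 :> R.
Proof.
apply: (@le_trans _ _ (4 - 4 / 2 ^+ n)); last by rewrite gerBl divr_ge0// exprn_ge0.
elim: n => [|n IH]; first by rewrite big_ord0 expr0 divr1 subrr.
rewrite big_ord_recr /=; apply: le_trans (lerD IH (lexx _)) _.
have h : (2 ^ n <= 2 * n`!)%N.
  elim: n {IH} => // n IH; rewrite expnS factS mulnCA; case: n IH => // n IH.
  by apply: leq_mul.
have h' : (n`!%:R)^-1 <= 2 / 2 ^+ n :> R.
  rewrite ler_pdivlMr ?exprn_gt0// mulrC ler_pdivrMr ?ltr0n ?fact_gt0//.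
  by rewrite -natrX -natrM ler_nat.
rewrite exprS invfM; move: h'; set x := (2 ^+ n)^-1; lra.
Qed.

(** Union bound over the outer sets. Counting them cancels the factorials of the two parts and
    leaves the inverse factorial of the window size, which makes the sum over sizes converge; the
    outer blocks may be smaller than [n] and [n'] because [cc] is nondecreasing. *)
Theorem cc_submul : exists2 K : R, 0 < K &
  forall n n', cc p theta (n + n') <= K * (cc p theta n * cc p theta n').
Proof.
have [S S0 hS] := linear_geometric_bound theta_gt0.
have [G G0 hG] := block_cost_bound S0.
(* [16] is the product of two sums of inverse factorials, each at most [4]; the [1] only makes the
   constant positive. *)
exists (16 * G + 1); first by rewrite ltr_wpDl// mulr_ge0.
move=> n n'; pose N := (n + n')%N; pose c := cc p theta.
pose cost k := expR (2 * p%:R * (k%:R + S) ^+ 2 + mid_cost p theta k) : R.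
have cI : #|'I_N| = (n + n')%N by rewrite card_ord.
pose valid (A B : {set 'I_N}) := [&& B \subset ~: A, #|A| <= n & #|B| <= n']%N.
have step1 : tsum p (@nat_of_ord N) (@gweight _ p theta 'I_N) <=
   \sum_(A : {set 'I_N}) \sum_(B : {set 'I_N} | valid A B)
     tsum p (@nat_of_ord N) (fun m => gweight p theta m * `[< pile_sets S A B m >]%:R).
  under eq_bigr => A _ do rewrite -tsum_sum.
  rewrite -tsum_sum; apply: ler_tsum => f tf.
  have [A [B [dAB hA hB hm]]] := pile_sets_exist S0 hS (score f) cI.
  rewrite (bigD1 A)//= (bigD1 B) /=; last by rewrite /valid dAB hA hB.
  rewrite (_ : `[< _ >] = true) ?mulr1; last exact/asboolP.
  have g0 : 0 <= gweight p theta (score f) by exact/ltW/gweight_gt0.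
  by rewrite -addrA lerDl addr_ge0// sumr_ge0// => ? _; rewrite ?mulr_ge0// sumr_ge0// => ? _; rewrite mulr_ge0.
have c0 k : 0 <= c k by exact: cc_ge0.
have co0 k : 0 <= cost k by exact: expR_ge0.
pose g a b := cost (N - a - b)%N * (a`!%:R * c a * (b`!%:R * c b)).
have g_ge0 a b : 0 <= g a b by rewrite /g; apply: mulr_ge0 => //; apply: mulr_ge0; exact: mulr_ge0.
have step2 : tsum p (@nat_of_ord N) (@gweight _ p theta 'I_N) <=
   \sum_(A : {set 'I_N} | (#|A| <= n)%N) \sum_(B : {set 'I_N} | (B \subset ~: A) && (#|B| <= n')%N) g #|A| #|B|.
  apply: le_trans step1 _; rewrite [leRHS]big_mkcond /=; apply: ler_sum => A _.
  case: ifPn => hA; last first.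
    by rewrite big_pred0// => B; rewrite /valid (negPf hA) andbF.
  rewrite (eq_bigl (fun B : {set 'I_N} => (B \subset ~: A) && (#|B| <= n')%N)); last first.
    by move=> B; rewrite /valid hA.
  apply: ler_sum => B /andP[BA _].
  apply: le_trans (tsum_pile_sets S0 (@ord_inj _) BA) _.
  have -> : #|~: (A :|: B)| = (N - #|A| - #|B|)%N.
    have := cardsC (A :|: B); rewrite card_ord.
    have AB0 : A :&: B = finset.set0.
      apply/setP => i; rewrite finset.in_setI finset.in_set0; apply/negbTE/negP => /andP[iA].
      by move=> /(fintype.subsetP BA); rewrite finset.in_setC iA.
    by have := cardsUI A B; rewrite AB0 cards0 addn0 => ->; lia.
  by [].
have step3 : \sum_(A : {set 'I_N} | (#|A| <= n)%N) \sum_(B : {set 'I_N} | (B \subset ~: A) && (#|B| <= n')%N) g #|A| #|B| =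
   \sum_(a < n.+1) \sum_(b < n'.+1) 'C(N, a)%:R * 'C(N - a, b)%:R * g a b.
  rewrite (partition_big (fun A : {set 'I_N} => inord #|A| : 'I_n.+1) xpredT) //=.
  apply: eq_bigr => a _.
  have EA (A : {set 'I_N}) : ((#|A| <= n) && (inord #|A| == a :> 'I_n.+1))%N = (#|A| == a)%N.
    apply/andP/eqP => [[h /eqP <-]|e]; first by rewrite inordK.
    split; first by rewrite e -ltnS.
    by apply/eqP/val_inj; rewrite /= inordK// e.
  rewrite (eq_bigl _ _ EA).
  rewrite (eq_bigr (fun=> \sum_(b < n'.+1) 'C(N - a, b)%:R * g a b)); last first.
    move=> A /eqP cA.
    rewrite (partition_big (fun B : {set 'I_N} => inord #|B| : 'I_n'.+1) xpredT) //=.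
    apply: eq_bigr => b _.
    have EB (B : {set 'I_N}) : ((B \subset ~: A) && (#|B| <= n') && (inord #|B| == b :> 'I_n'.+1))%N =
        (B \subset ~: A) && (#|B| == b)%N.
      rewrite -andbA; congr (_ && _); apply/andP/eqP => [[h /eqP <-]|e]; first by rewrite inordK.
      split; first by rewrite e -ltnS.
      by apply/eqP/val_inj; rewrite /= inordK// e.
    rewrite (eq_bigl _ _ EB) (eq_bigr (fun=> g a b)); last by move=> B /andP[_ /eqP ->]; rewrite cA.
    rewrite sumr_const -[LHS]mulr_natl; congr (_%:R * _).
    have cC : #|~: A| = (N - a)%N by rewrite cardsCs finset.setCK card_ord cA.
    have := cards_draws (~: A) b; rewrite cC => <-.
    by apply: eq_card => B; rewrite !inE.
  rewrite sumr_const -[LHS]mulr_natl mulr_sumr.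
  have -> : #|[pred A : {set 'I_N} | #|A| == a]| = 'C(N, a).
    have := card_draws 'I_N a; rewrite card_ord => <-.
    by apply: eq_card => A; rewrite !inE.
  by apply: eq_bigr => b _; rewrite mulrA.
have step4 : \sum_(a < n.+1) \sum_(b < n'.+1) 'C(N, a)%:R * 'C(N - a, b)%:R * g a b <=
   N`!%:R * (G * (c n * c n') * 16).
  apply: (@le_trans _ _ (\sum_(a < n.+1) \sum_(b < n'.+1)
     (N`!%:R * (G * (c n * c n'))) * (((n - a)`!%:R)^-1 * ((n' - b)`!%:R)^-1))).
    apply: ler_sum => a _; apply: ler_sum => b _.
    have an : (a <= n)%N by rewrite -ltnS.
    have bn : (b <= n')%N by rewrite -ltnS.
    have aN : (a <= N)%N by rewrite /N; lia.
    have bN : (b <= N - a)%N by rewrite /N; lia.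
    have f0 k : 0 < k`!%:R :> R by rewrite ltr0n fact_gt0.
    have e1 : 'C(N, a)%:R * 'C(N - a, b)%:R * (a`!%:R * b`!%:R) = N`!%:R / (N - a - b)`!%:R :> R.
      have h1 : 'C(N, a)%:R * (a`!%:R * (N - a)`!%:R) = N`!%:R :> R by rewrite -2!natrM bin_fact.
      have h2 : 'C(N - a, b)%:R * (b`!%:R * (N - a - b)`!%:R) = (N - a)`!%:R :> R by rewrite -2!natrM bin_fact.
      rewrite -h1 -h2; move: (f0 (N - a - b)%N); move: ((N - a - b)`!%:R : R) => x x0.
      by field; exact: lt0r_neq0.
    have -> : 'C(N, a)%:R * 'C(N - a, b)%:R * g a b =
        N`!%:R * (cost (N - a - b)%N * (c a * c b)) * ((N - a - b)`!%:R)^-1.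
      transitivity (('C(N, a)%:R * 'C(N - a, b)%:R * (a`!%:R * b`!%:R)) * (cost (N - a - b)%N * (c a * c b))).
        rewrite /g; move: ('C(N, a)%:R : R) ('C(N - a, b)%:R : R) (a`!%:R : R) (b`!%:R : R) => *; ring.
      by rewrite e1 mulrAC.
    apply: ler_pM.
    - by apply: mulr_ge0 => //; apply: mulr_ge0 => //; exact: mulr_ge0.
    - by rewrite invr_ge0.
    - rewrite ler_wpM2l//; apply: ler_pM => //; [exact: mulr_ge0|exact: hG|].
      by apply: ler_pM => //; exact: cc_homo.
    (* The window size is [(n - a) + (n' - b)], and the factorial of a sum is at least the product
       of the factorials. This separates the sums over [a] and [b]. *)
    - rewrite -invfM lef_pV2 ?posrE ?mulr_gt0// -natrM ler_nat.
      have -> : (N - a - b)%N = ((n - a) + (n' - b))%N by rewrite /N; lia.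
      rewrite -(@bin_fact (n - a + (n' - b)) (n - a)) ?leq_addr// addKn.
      by rewrite leq_pmull// bin_gt0 leq_addr.
  under eq_bigr => a _ do rewrite -mulr_sumr -mulr_sumr.
  rewrite -mulr_sumr -mulr_suml [leRHS]mulrA ler_wpM2l//.
    by do 2 (apply: mulr_ge0 => //); exact: mulr_ge0.
  have rv k : \sum_(a < k.+1) ((k - a)`!%:R)^-1 <= 4 :> R.
    apply: le_trans (sum_inv_fact_le4 k.+1); rewrite (reindex_inj rev_ord_inj) /=.
    by apply: ler_sum => i _; rewrite subSS subKn// -ltnS.
  have -> : 16 = 4 * 4 :> R by ring.
  by apply: ler_pM => //; apply: sumr_ge0 => i _; rewrite invr_ge0.
rewrite -/N /cc ler_pdivrMr ?ltr0n ?fact_gt0// -/(cc _ _ _) -/(cc _ _ _).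
apply: le_trans step2 _; rewrite step3; apply: le_trans step4 _.
rewrite [leRHS]mulrC ler_wpM2l//.
have cc0 : 0 <= c n * c n' by exact: mulr_ge0.
by rewrite -/(c n) -/(c n'); move: cc0; set x := c n * c n'; nra.
Qed.

End Submultiplicative.

(** * The norm as a sum over tournaments *)

Section GaussTrigIntegrals.
Import numFieldNormedType.Exports.
Context {R : realType}.
Notation mu := (@lebesgue_measure R).

Lemma gauss_exp_fun (l a x : R) : 0 < l ->
  expR (a * x - x ^+ 2 / l ^+ 2) =
  (l * Num.sqrt pi * expR (a ^+ 2 * l ^+ 2 / 4)) * normal_pdf (a * l ^+ 2 / 2) (l / Num.sqrt 2) x.
Proof.
move=> l0; have s20 : 0 < Num.sqrt 2 :> R by rewrite sqrtr_gt0.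
have s2 : (l / Num.sqrt 2) ^+ 2 *+ 2 = l ^+ 2.
  by rewrite exprMn exprVn sqr_sqrtr// -mulr_natr divfK.
have pi0 : 0 < Num.sqrt (pi : R) by rewrite sqrtr_gt0 pi_gt0.
have K0 : l * Num.sqrt pi != 0 by rewrite gt_eqF// mulr_gt0.
have pk : normal_peak (l / Num.sqrt 2) = (l * Num.sqrt pi)^-1.
  by rewrite /normal_peak -mulrnAl s2 sqrtrM ?sqr_ge0// sqrtr_sqr gtr0_norm.
have -> : expR (a * x - x ^+ 2 / l ^+ 2) = expR (a ^+ 2 * l ^+ 2 / 4) * expR (- (x - a * l ^+ 2 / 2) ^+ 2 / l ^+ 2).
  by rewrite -expRD; congr expR; field; exact: lt0r_neq0.
rewrite normal_pdfE; last by rewrite gt_eqF// divr_gt0.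
rewrite pk /normal_fun s2; move: (expR _) (expR _) (l * Num.sqrt pi) K0 => u v K K0.
by field.
Qed.

Lemma integrable_gauss_exp (l a : R) : 0 < l ->
  mu.-integrable setT (fun x => (expR (a * x - x ^+ 2 / l ^+ 2))%:E).
Proof.
move=> l0; under eq_fun do rewrite gauss_exp_fun// EFinM.
by apply: integrableZl => //; exact: integrable_normal_pdf.
Qed.

Lemma integral_gauss_exp (l a : R) : 0 < l ->
  (\int[mu]_x (expR (a * x - x ^+ 2 / l ^+ 2))%:E)%E = (l * Num.sqrt pi * expR (a ^+ 2 * l ^+ 2 / 4))%:E.
Proof.
move=> l0; under eq_integral do rewrite gauss_exp_fun// EFinM.
rewrite integralZl//; last exact: integrable_normal_pdf.
by rewrite integral_normal_pdf mule1.
Qed.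

Section Circle.
Variables (Rc : R).
Hypothesis Rc0 : 0 < Rc.
Notation circ := `[0%R, (2 * pi * Rc)%R]%classic.

Let per0 : 0 < 2 * pi * Rc.
Proof. by rewrite mulr_gt0// mulr_gt0// pi_gt0. Qed.

Lemma continuous_cos_lin (phi b : R) : continuous (fun y : R => cos (phi + b * (y / Rc))).
Proof.
move=> y; apply: (@continuous_comp _ _ _ (fun y : R => phi + b * (y / Rc)) cos); last exact: continuous_cos.
apply: cvgD; first exact: cvg_cst.
by apply: cvgM; [exact: cvg_cst|apply: cvgM; [exact: cvg_id|exact: cvg_cst]].
Qed.

Lemma sin_period_int (x : R) (b : int) : sin (x + b%:~R * (pi *+ 2)) = sin x.
Proof.
have P := periodicn (@sinD2pi R).
case: b => n; first by rewrite -pmulrn mulr_natl P.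
by rewrite NegzE mulrNz mulNr -pmulrn mulr_natl -[in RHS](subrK (pi *+ 2 *+ n.+1) x) P.
Qed.

(** Orthogonality of the angular modes. The phase [phi] carries the angles of the other
    particles. *)
Lemma integral_cos_circle (phi : R) (b : int) :
  (\int[mu]_(y in circ) (cos (phi + b%:~R * (y / Rc)))%:E)%E =
  ((if b == 0 then 2 * pi * Rc else 0) * cos phi)%:E.
Proof.
have [->|b0] := eqVneq b 0.
  transitivity (\int[mu]_(y in circ) (cst (cos phi)%:E) y)%E.
    by apply: eq_integral => y _; rewrite mul0r addr0.
  rewrite integral_cst//= lebesgue_measure_itv /= lte_fin per0.
  by rewrite -EFinD -EFinM subr0 mulrC.
have bR : b%:~R != 0 :> R by rewrite intr_eq0.
pose F (y : R) := Rc / b%:~R * sin (phi + b%:~R * (y / Rc)).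
have dF (y : R) : is_derive y (1 : R) F (cos (phi + b%:~R * (y / Rc))).
  have : is_derive y (1 : R) (fun y : R => phi + b%:~R * (y / Rc)) (b%:~R / Rc).
    have -> : (fun y : R => phi + b%:~R * (y / Rc)) = (cst phi + (b%:~R / Rc) *: id)%R.
      by apply/funext => z; rewrite /= !fctE /cst; congr (_ + _); rewrite /GRing.scale /= mulrCA mulrC.
    apply: is_derive_eq; rewrite add0r /GRing.scale /=; exact: mulr1.
  move=> d1.
  have d2 := @is_derive1_comp _ sin (fun y : R => phi + b%:~R * (y / Rc)) y _ _ (is_derive_sin _) d1.
  have := is_deriveZ (Rc / b%:~R) d2.
  rewrite /F => d3; apply: is_derive_eq d3 _.
  rewrite /GRing.scale /=; field; rewrite bR gt_eqF//.
have cF : continuous F.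
  move=> y; apply: differentiable_continuous; apply/derivable1_diffP.
  by case: (dF y).
rewrite (@continuous_FTC2 _ (fun y => cos (phi + b%:~R * (y / Rc))) F)//.
- rewrite -EFinB mul0r /F mul0r mulr0 addr0.
  have -> : b%:~R * (2 * pi * Rc / Rc) = b%:~R * (pi *+ 2) :> R.
    by rewrite mulfK ?gt_eqF// mulr_natl.
  by rewrite sin_period_int subrr.
- by apply: continuous_subspaceT; exact: continuous_cos_lin.
- split.
  + by move=> y _; case: (dF y).
  + by apply: cvg_at_right_filter; exact: cF.
  + by apply: cvg_at_left_filter; exact: cF.
- by move=> y _; rewrite derive1E; case: (dF y).
Qed.

Lemma integral_trig_circle (T : finType) (d phi : T -> R) (b : T -> int) :
  (\int[mu]_(y in circ) (\sum_t d t * cos (phi t + (b t)%:~R * (y / Rc)))%:E)%E =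
  (\sum_t d t * ((if b t == 0 then 2 * pi * Rc else 0) * cos (phi t)))%:E.
Proof.
have ic t : mu.-integrable circ (fun y => (cos (phi t + (b t)%:~R * (y / Rc)))%:E).
  apply: continuous_compact_integrable; first exact: segment_compact.
  by apply: continuous_subspaceT; exact: continuous_cos_lin.
have id t : mu.-integrable circ (fun y => (d t * cos (phi t + (b t)%:~R * (y / Rc)))%:E).
  rewrite (_ : (fun y => _) = (fun y => (d t)%:E * (cos (phi t + (b t)%:~R * (y / Rc)))%:E)%E).
    exact: integrableZl.
  by apply/funext => y; rewrite EFinM.
under eq_integral do rewrite -sumEFin.
rewrite (integral_sum _ id)//.
rewrite -sumEFin; apply: eq_bigr => t _.
under eq_integral do rewrite EFinM.
by rewrite integralZl// integral_cos_circle -EFinM.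
Qed.

End Circle.

Lemma integral_gauss_sum (T : finType) (l : R) (d a : T -> R) : 0 < l ->
  (\int[mu]_x (\sum_t d t * expR (a t * x - x ^+ 2 / l ^+ 2))%:E)%E =
  (\sum_t d t * (l * Num.sqrt pi * expR (a t ^+ 2 * l ^+ 2 / 4)))%:E.
Proof.
move=> l0; have ic t := integrable_gauss_exp (a t) l0.
have id t : mu.-integrable setT (fun x => (d t * expR (a t * x - x ^+ 2 / l ^+ 2))%:E).
  by under eq_fun do rewrite EFinM; exact: integrableZl.
under eq_integral do rewrite -sumEFin.
rewrite (integral_sum _ id)//.
rewrite -sumEFin; apply: eq_bigr => t _.
under eq_integral do rewrite EFinM.
by rewrite integralZl// integral_gauss_exp// -EFinM.
Qed.

(** The first particle is integrated last. While it is frozen, its angle joins [phi] and its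
    Gaussian factor joins [c]; the induction therefore needs both to be arbitrary. *)
Lemma iint_trig (Rc l : R) n (T : finType) (c phi : T -> R) (a : T -> nat -> R) (b : T -> nat -> int) :
  0 < Rc -> 0 < l ->
  iint_Z Rc n (fun s => (\sum_t c t *
     ((\prod_(k < n) expR (a t k * (nth (0, 0) s k).1 - (nth (0, 0) s k).1 ^+ 2 / l ^+ 2)) *
      cos (phi t + \sum_(k < n) (b t k)%:~R * ((nth (0, 0) s k).2 / Rc))))%:E) =
  (\sum_t c t * ((\prod_(k < n) ((if b t k == 0 then 2 * pi * Rc else 0) *
     (l * Num.sqrt pi * expR (a t k ^+ 2 * l ^+ 2 / 4)))) * cos (phi t)))%:E.
Proof.
move=> Rc0 l0; elim: n c phi a b => [|n IH] c phi a b /=.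
  by congr (_%:E); apply: eq_bigr => t _; rewrite !big_ord0 addr0.
pose W t := \prod_(k < n) ((if b t k.+1 == 0 then 2 * pi * Rc else 0) *
     (l * Num.sqrt pi * expR (a t k.+1 ^+ 2 * l ^+ 2 / 4))).
have inner x y : iint_Z Rc n (fun s => (\sum_t c t *
     ((\prod_(k < n.+1) expR (a t k * (nth (0, 0) ((x, y) :: s) k).1 - (nth (0, 0) ((x, y) :: s) k).1 ^+ 2 / l ^+ 2)) *
      cos (phi t + \sum_(k < n.+1) (b t k)%:~R * ((nth (0, 0) ((x, y) :: s) k).2 / Rc))))%:E) =
   (\sum_t (c t * expR (a t 0%N * x - x ^+ 2 / l ^+ 2) * W t) * cos (phi t + (b t 0%N)%:~R * (y / Rc)))%:E.
  transitivity (iint_Z Rc n (fun s => (\sum_t (c t * expR (a t 0%N * x - x ^+ 2 / l ^+ 2)) *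
     ((\prod_(k < n) expR (a t k.+1 * (nth (0, 0) s k).1 - (nth (0, 0) s k).1 ^+ 2 / l ^+ 2)) *
      cos ((phi t + (b t 0%N)%:~R * (y / Rc)) + \sum_(k < n) (b t k.+1)%:~R * ((nth (0, 0) s k).2 / Rc))))%:E)).
    congr (iint_Z _ _ _); apply/funext => s; congr (_%:E); apply: eq_bigr => t _.
    by rewrite !big_ord_recl /= !mulrA addrA.
  rewrite (IH (fun t => c t * expR (a t 0%N * x - x ^+ 2 / l ^+ 2)) (fun t => phi t + (b t 0%N)%:~R * (y / Rc))
     (fun t k => a t k.+1) (fun t k => b t k.+1)).
  by congr (_%:E); apply: eq_bigr => t _; rewrite mulrA.
under eq_integral => x _.
  under eq_integral => y _ do rewrite inner.
  rewrite integral_trig_circle//.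
  rewrite (eq_bigr (fun t => (c t * W t * ((if b t 0%N == 0 then 2 * pi * Rc else 0) * cos (phi t))) *
     expR (a t 0%N * x - x ^+ 2 / l ^+ 2))); last by move=> t _; ring.
  over.
rewrite integral_gauss_sum//; congr (_%:E); apply: eq_bigr => t _.
by rewrite big_ord_recl /= -/(W t); ring.
Qed.

End GaussTrigIntegrals.

Section PolarForm.
Import complex.
Context {R : realType}.
Local Open Scope complex_scope.

Definition cis (r t : R) : R[i] := (r * cos t) +i* (r * sin t).

Lemma cisM r t r' t' : cis r t * cis r' t' = cis (r * r') (t + t').
Proof.
by rewrite /cis; simpc; rewrite cosD sinD; congr (_ +i* _); ring.
Qed.

Lemma cis1 : cis 1 0 = 1.
Proof. by rewrite /cis cos0 sin0 mulr0 mulr1. Qed.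

Lemma cisX r t n : cis r t ^+ n = cis (r ^+ n) (n%:R * t).
Proof.
elim: n => [|n IH]; first by rewrite !expr0 mul0r cis1.
by rewrite !exprS IH cisM -natr1; congr cis; ring.
Qed.

Lemma cis_prod (I : finType) (r t : I -> R) :
  \prod_i cis (r i) (t i) = cis (\prod_i r i) (\sum_i t i).
Proof.
elim/big_rec3: _ => [|i x y z _ ->]; first by rewrite cis1.
by rewrite cisM.
Qed.

Lemma Re_realM (x : R) (z : R[i]) : Re (x%:C * z) = x * Re z.
Proof. by case: z => a b; simpc. Qed.

(** The squared modulus is the product of the Vandermonde powers in [Z] and in its conjugate [Zc].
    It is real, so taking real parts after the expansion leaves only cosines. *)
Lemma vandermonde_sq (p : nat) (I : finType) (o : I -> nat) (r t : I -> R) : injective o ->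
  \prod_(x : I * I | (o x.1 < o x.2)%N)
    ((r x.2 * cos (t x.2) - r x.1 * cos (t x.1)) ^+ 2 +
     (r x.2 * sin (t x.2) - r x.1 * sin (t x.1)) ^+ 2) ^+ p =
  \sum_(f : {ffun I * I -> 'I_p.+1} | tournament f) \sum_(g : {ffun I * I -> 'I_p.+1} | tournament g)
    tweight R o f * tweight R o g *
    ((\prod_i r i ^+ (score f i + score g i)) * cos (\sum_i ((score f i)%:R - (score g i)%:R) * t i)).
Proof.
move=> io; pose Z i := cis (r i) (t i); pose Zc i := cis (r i) (- t i).
have wC (f : {ffun I * I -> 'I_p.+1}) : tweight R[i] o f = (tweight R o f)%:C.
  rewrite /tweight [RHS]rmorph_prod; apply: eq_bigr => x _.
  by rewrite rmorphM rmorphXn rmorphN1 rmorph_nat.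
have -> : \prod_(x : I * I | (o x.1 < o x.2)%N)
    ((r x.2 * cos (t x.2) - r x.1 * cos (t x.1)) ^+ 2 +
     (r x.2 * sin (t x.2) - r x.1 * sin (t x.1)) ^+ 2) ^+ p =
   Re ((\prod_(x : I * I | (o x.1 < o x.2)%N) (Z x.2 - Z x.1) ^+ p) *
       (\prod_(x : I * I | (o x.1 < o x.2)%N) (Zc x.2 - Zc x.1) ^+ p)).
  rewrite -big_split /=; set P := LHS; rewrite -[P]/(Re P%:C) /P rmorph_prod; congr Re.
  apply: eq_bigr => x _; rewrite -exprMn rmorphXn; congr (_ ^+ p).
  by rewrite /Z /Zc /cis /= !cosN !sinN; simpc; congr (_ +i* _); ring.
rewrite (@vandermonde_tournament p _ _ _ io Z) (@vandermonde_tournament p _ _ _ io Zc) big_distrlr /= raddf_sum; apply: eq_bigr => f tf.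
rewrite raddf_sum; apply: eq_bigr => g tg /=.
rewrite !wC mulrACA -rmorphM [X in Re (_ * X)]mulrC Re_realM; congr (_ * _); rewrite -big_split /=.
under eq_bigr => i _ do rewrite /Z /Zc !cisX cisM.
rewrite cis_prod /=; congr (_ * cos _).
  by apply: eq_bigr => i _; rewrite -exprD addnC.
by apply: eq_bigr => i _; rewrite mulrN mulrBl addrC.
Qed.

End PolarForm.

Section LaughlinNorm.
Context {R : realType}.
Variables (Rc l : R) (p : nat).
Hypotheses (Rc0 : 0 < Rc) (l0 : 0 < l).

Lemma eq_iint_Z n (F G : seq (R * R) -> \bar R) :
  (forall s, size s = n -> F s = G s) -> iint_Z Rc n F = iint_Z Rc n G.
Proof.
elim: n F G => [|n IH] F G FG /=; first exact: FG.
apply: eq_integral => x _; apply: eq_integral => y _; apply: IH => s sn.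
by apply: FG; rewrite /= sn.
Qed.

Lemma prod_below (N : nat) (F : nat -> nat -> R) :
  \prod_(0 <= k < N) \prod_(0 <= j < k) F k j =
  \prod_(x : 'I_N * 'I_N | (x.1 < x.2)%N) F x.2 x.1.
Proof.
rewrite big_mkord -(pair_big_dep xpredT (fun i j : 'I_N => (i < j)%N) (fun i j : 'I_N => F j i)) /=.
rewrite [RHS](exchange_big_dep xpredT)//=; apply: eq_bigr => k _.
by rewrite big_mkord (big_ord_widen N (fun j => F k j))// ltnW.
Qed.

(** [iint_trig] indexes exponents by [nat], since its induction shifts indices; the default [0] is
    never reached. *)
Definition extend N (m : {ffun 'I_N -> nat}) (k : nat) : nat := oapp m 0%N (insub k).

Lemma extendE N (m : {ffun 'I_N -> nat}) (k : 'I_N) : extend m k = m k.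
Proof. by rewrite /extend valK. Qed.

Lemma laughlin_sqE N (s : seq (R * R)) : size s = N ->
  laughlin_sq Rc l p s = \sum_(fg : {ffun 'I_N * 'I_N -> 'I_p.+1} * {ffun 'I_N * 'I_N -> 'I_p.+1})
   (if tournament fg.1 && tournament fg.2 then kappa Rc l p N ^+ 2 * (tweight R (@nat_of_ord N) fg.1 * tweight R (@nat_of_ord N) fg.2) else 0) *
     ((\prod_(k < N) expR (((extend (score fg.1) k + extend (score fg.2) k)%:R / Rc) * (nth (0, 0) s k).1 - (nth (0, 0) s k).1 ^+ 2 / l ^+ 2)) *
      cos (0 + \sum_(k < N) ((extend (score fg.1) k)%:Z - (extend (score fg.2) k)%:Z)%:~R * ((nth (0, 0) s k).2 / Rc))).
Proof.
move=> sN; rewrite /laughlin_sq sN (prod_below N (fun k j => cexp_sqdist Rc (nth (0, 0) s k) (nth (0, 0) s j) ^+ p)).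
rewrite /cexp_sqdist /cexp_re /cexp_im.
rewrite (vandermonde_sq p (fun k : 'I_N => expR ((nth (0, 0) s k).1 / Rc)) (fun k : 'I_N => (nth (0, 0) s k).2 / Rc) (@ord_inj N)).
set G := expR _ ^+ 2.
have GE : G = \prod_(k < N) expR (- ((nth (0, 0) s k).1 ^+ 2 / l ^+ 2)).
  rewrite /G -expRM_natl big_mkord -expR_sum; congr expR.
  rewrite !mulr_sumr; apply: eq_bigr => k _; field; exact: lt0r_neq0.
rewrite pair_big /= mulr_sumr mulr_suml big_mkcond /=; apply: eq_bigr => -[f g] _ /=.
case: ifP => _; last by rewrite mul0r.
set C := cos _; set D := cos _.
have -> : C = D.
  rewrite /C /D add0r; congr cos; apply: eq_bigr => k _.
  by rewrite !extendE rmorphB /= -!pmulrn.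
set A := \prod_(i < N) _; set B := \prod_(k < N) _.
have -> : B = A * G.
  rewrite GE /A /B -big_split /=; apply: eq_bigr => k _.
  by rewrite !extendE -expRM_natl -expRD; congr expR; ring.
by move: (kappa _ _ _ _ ^+ 2) (tweight _ _ _) (tweight _ _ _) => *; ring.
Qed.

(** The angular integrals leave only pairs with equal scores. The Gaussian integrals then give
    [exp (gam^2 m_i^2)] for each particle, and [kappa] removes the volume factor and the reference
    energy. *)
Theorem CN_cc N : CN Rc l p N = (cc p ((l / Rc) ^+ 2) N)%:E.
Proof.
rewrite /CN; under eq_iint_Z => s sN do rewrite (laughlin_sqE sN).
have := @iint_trig R Rc l N _ (fun fg : {ffun 'I_N * 'I_N -> 'I_p.+1} * {ffun 'I_N * 'I_N -> 'I_p.+1} =>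
  if tournament fg.1 && tournament fg.2 then kappa Rc l p N ^+ 2 * (tweight R (@nat_of_ord N) fg.1 * tweight R (@nat_of_ord N) fg.2) else 0)
  (fun=> 0) (fun fg k => (extend (score fg.1) k + extend (score fg.2) k)%:R / Rc)
  (fun fg k => (extend (score fg.1) k)%:Z - (extend (score fg.2) k)%:Z) Rc0 l0.
move=> ->; congr (_%:E); rewrite /cc /tsum.
rewrite -(pair_bigA _ (fun f g : {ffun 'I_N * 'I_N -> 'I_p.+1} =>
  (if tournament f && tournament g then kappa Rc l p N ^+ 2 * (tweight R (@nat_of_ord N) f * tweight R (@nat_of_ord N) g) else 0) *
  ((\prod_(k < N) ((if (extend (score f) k)%:Z - (extend (score g) k)%:Z == 0 then 2 * pi * Rc else 0) *
     (l * Num.sqrt pi * expR (((extend (score f) k + extend (score g) k)%:R / Rc) ^+ 2 * l ^+ 2 / 4)))) * cos 0))) /=.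
rewrite mulr_suml [RHS]big_mkcond /=; apply: eq_bigr => f _.
case: ifPn => tf; last by rewrite big1// => g _; rewrite mul0r.
rewrite mulr_suml [RHS]big_mkcond /=; apply: eq_bigr => g _.
case: (boolP (tournament g)) => tg /=; last by rewrite mul0r.
have [e|ne] := eqVneq (score g) (score f); last first.
  have [k hk] : exists k, score g k != score f k.
    by apply/existsP; apply: contraR ne => /existsPn h; apply/eqP/ffunP => k; apply/eqP; rewrite -[_ == _]negbK.
  rewrite (bigD1 k)//= !extendE subr_eq0 eqz_nat eq_sym (negPf hk) !mul0r mulr0//.
rewrite cos0 mulr1 e.
under eq_bigr => k _.
  rewrite subrr eqxx (_ : _ * (_ * expR _) = (2 * pi * Rc * l * Num.sqrt pi) * expR ((l / Rc) ^+ 2 * (score f k)%:R ^+ 2)).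
  over.
    rewrite !extendE natrD -!mulrA; do 5 congr (_ * _); congr expR; field; exact: lt0r_neq0.
rewrite big_split /= prodr_const card_ord -expR_sum -mulr_sumr.
set X := 2 * pi * Rc * l * Num.sqrt pi.
have X0 : 0 < X by rewrite /X !mulr_gt0 ?pi_gt0// sqrtr_gt0 pi_gt0.
have kE : kappa Rc l p N ^+ 2 = (N`!%:R)^-1 * (X ^+ N)^-1 *
    expR (- ((l / Rc) ^+ 2 * \sum_(k < N) ((p * k)%:R - 0) ^+ 2)).
  rewrite /kappa -/X; move: X X0 => Y Y0.
  rewrite 2!exprMn exprVn sqr_sqrtr//; congr (_ * _ * _).
    by rewrite -[LHS]powR_mulrn ?powR_ge0// -powRrM mulNr divfK// powRN powR_mulrn// ltW.
  rewrite -expRM_natl; congr expR; rewrite big_add1 /= big_mkord /gam !mulr_sumr -sumrN.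
  by apply: eq_bigr => k _; rewrite subn1 /= subr0 natrM; field; exact: lt0r_neq0.
rewrite kE /gweight /energy card_ord mulrBr expRD.
have -> : \sum_i ((score f i)%:R - 0) ^+ 2 = \sum_(i < N) (score f i)%:R ^+ 2 :> R.
  by apply: eq_bigr => i _; rewrite subr0.
have XN : X ^+ N != 0 by rewrite gt_eqF// exprn_gt0.
have fN : N`!%:R != 0 :> R by rewrite pnatr_eq0 -lt0n fact_gt0.
move: (expR _) (expR _) (X ^+ N) XN (N`!%:R : R) fN => u v x x0 y y0.
by field; rewrite x0 y0.
Qed.

End LaughlinNorm.

(** * Positivity of the limit *)

Section GrowthRate.
Import numFieldNormedType.Exports.
Context {R : realType}.
Variable u : nat -> R.
Hypothesis u_gt0 : forall N, 0 < u N.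
Hypothesis u0 : u 0%N = 1.
Hypothesis u_rate : (fun N => ln (u N) / N%:R) @ \oo --> 0.

Let rate_small (e : R) N : 0 < e -> (0 < N)%N -> exists2 j, (0 < j)%N & `|ln (u (j * N)%N)| <= e * (j * N)%:R.
Proof.
move=> e0 N0; move/cvgrPdist_le: u_rate => /(_ _ e0)[n0 _ h].
exists n0.+1 => //; have /= := h (n0.+1 * N)%N; rewrite sub0r normrN.
have jN : (0 < n0.+1 * N)%N by rewrite muln_gt0.
rewrite normrM normfV normr_nat ler_pdivrMr ?ltr0n//; apply.
by rewrite (@leq_trans n0.+1)// leq_pmulr.
Qed.

(** If [q = K * u N] were below 1, then [K * u (j N) <= q^j] would decay exponentially,
    contradicting the zero rate. *)
Lemma submul_ge (K : R) : (forall n m, u (n + m)%N <= K * (u n * u m)) -> forall N, K^-1 <= u N.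
Proof.
move=> hK; have K1 : 1 <= K by have := hK 0%N 0%N; rewrite u0 !mulr1.
have K0 : 0 < K by lra.
case=> [|N]; first by rewrite u0 invf_le1.
rewrite leNgt; apply/negP => uK.
pose q := K * u N.+1.
have q0 : 0 < q by rewrite mulr_gt0.
have q1 : q < 1 by rewrite /q mulrC -ltr_pdivlMr// mul1r.
have pow j : K * u (j.+1 * N.+1)%N <= q ^+ j.+1.
  elim: j => [|j IH]; first by rewrite mul1n expr1.
  rewrite mulSn [q ^+ j.+2]exprS.
  apply: (@le_trans _ _ (K * (K * (u N.+1 * u (j.+1 * N.+1)%N)))); first by rewrite ler_pM2l.
  have -> : K * (K * (u N.+1 * u (j.+1 * N.+1)%N)) = q * (K * u (j.+1 * N.+1)%N) by rewrite /q; ring.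
  by rewrite ler_pM2l.
have lq : ln q < 0 by rewrite ln_lt0// q0 q1.
(* Half the exponential rate that [pow] would force. *)
pose e := - ln q / (2 * N.+1%:R).
have e0 : 0 < e by rewrite divr_gt0 ?oppr_gt0// mulr_gt0.
have [[//|j] _ hj] := rate_small e0 (ltn0Sn N).
have h1 : ln K + ln (u (j.+1 * N.+1)%N) <= j.+1%:R * ln q.
  rewrite -lnM ?posrE//; apply: (@le_trans _ _ (ln (q ^+ j.+1))).
    by rewrite ler_ln ?posrE ?mulr_gt0 ?exprn_gt0.
  by rewrite lnXn// mulr_natl.
have h2 : - (e * (j.+1 * N.+1)%:R) <= ln (u (j.+1 * N.+1)%N).
  by move: hj; rewrite ler_norml => /andP[].
have h3 : e * (j.+1 * N.+1)%:R = - (j.+1%:R * ln q) / 2.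
  by rewrite /e natrM; field.
have h4 : 0 <= ln K by exact: ln_ge0.
have h5 : j.+1%:R * ln q < 0 by rewrite nmulr_llt0.
move: h1 h2; rewrite h3; lra.
Qed.

(** A value above 1 would force exponential growth along its multiples. *)
Lemma supermul_le1 : (forall n m, u n * u m <= u (n + m)%N) -> forall N, u N <= 1.
Proof.
move=> hS; case=> [|N]; first by rewrite u0.
rewrite leNgt; apply/negP => u1.
have pow j : u N.+1 ^+ j <= u (j * N.+1)%N.
  elim: j => [|j IH]; first by rewrite mul0n u0 expr0.
  rewrite mulSn exprS; apply: le_trans (hS _ _).
  by rewrite ler_pM2l.
have lu : 0 < ln (u N.+1) by rewrite ln_gt0.
pose e := ln (u N.+1) / (2 * N.+1%:R).
have e0 : 0 < e by rewrite divr_gt0// mulr_gt0.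
have [j j0 hj] := rate_small e0 (ltn0Sn N).
have h1 : j%:R * ln (u N.+1) <= ln (u (j * N.+1)%N).
  apply: (@le_trans _ _ (ln (u N.+1 ^+ j))); first by rewrite lnXn// mulr_natl.
  by rewrite ler_ln ?posrE ?exprn_gt0.
have h2 : ln (u (j * N.+1)%N) <= e * (j * N.+1)%:R.
  by move: hj; rewrite ler_norml => /andP[].
have h3 : e * (j * N.+1)%:R = j%:R * ln (u N.+1) / 2.
  by rewrite /e natrM; field.
have h4 : 0 < j%:R * ln (u N.+1) by rewrite mulr_gt0// ltr0n.
move: h1 h2; rewrite h3; lra.
Qed.

End GrowthRate.

Section FactorialGrowth.
Import numFieldNormedType.Exports.
Context {R : realType}.

Lemma leq_expn_fact k j : (k ^ j <= (k + j)`!)%N.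
Proof.
elim: j => [|j IH]; first by rewrite expn0 fact_gt0.
by rewrite addnS factS expnS leq_mul// ltnW// ltnS leq_addr.
Qed.

(** For [p = 0], where [C_N = 1/N!], this refutes the assumed growth rate. *)
Lemma fact_rate_diverges (a : R) : ~ ((fun N => ln ((N`!%:R)^-1 : R) / N%:R) @ \oo --> a).
Proof.
move=> /cvgrPdist_le/(_ 1 ltr01)[n0 _ h].
have [M M0 aM] : exists2 M : R, 0 < M & `|a| + 1 <= M.
  by exists (`|a| + 1) => //; rewrite ltr_wpDl.
pose k := (Num.truncn (expR (2 * (M + 1)))).+1.
have kM : 2 * (M + 1) <= ln k%:R.
  rewrite -[leLHS]expRK ler_ln ?posrE ?expR_gt0 ?ltr0n//.
  by rewrite ltW// truncnS_gt.
(* [leq_expn_fact] gives [ln N! >= (k + n0) * ln k]. Since [k + n0] is at least half of [N], the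
   choice [ln k >= 2 (M + 1)] exceeds the bound [M * N]. *)
pose N := (k + (k + n0))%N.
have N0 : (0 < N)%N by rewrite /N /k.
have /= := h N; rewrite (_ : (n0 <= N)%N); last by rewrite /N; lia.
move=> /(_ isT).
rewrite lnV ?posrE ?ltr0n ?fact_gt0// => hd.
have lnN : (k + n0)%:R * ln k%:R <= ln (N`!%:R : R).
  apply: (@le_trans _ _ (ln (k%:R ^+ (k + n0) : R))); first by rewrite lnXn// ?ltr0n// mulr_natl.
  by rewrite ler_ln ?posrE ?exprn_gt0 ?ltr0n ?fact_gt0// -natrX ler_nat leq_expn_fact.
have up : ln (N`!%:R : R) / N%:R <= M.
  have := ler_norm (a - - ln (N`!%:R) / N%:R); have := ler_norm (- a); rewrite normrN mulNr.
  by move: hd; rewrite mulNr; lra.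
move: up; rewrite ler_pdivrMr ?ltr0n// => up.
have NE : N%:R = k%:R + (k + n0)%:R :> R by rewrite /N natrD.
have kn : k%:R <= (k + n0)%:R :> R by rewrite ler_nat leq_addr.
have k0 : 0 < k%:R :> R by rewrite ltr0n.
have kn0 : 0 < (k + n0)%:R :> R by lra.
move: up lnN; rewrite NE; move: kM k0 kn0 kn; move: (ln (N`!%:R)) (ln (k%:R : R)) => x y.
move: (k%:R : R) ((k + n0)%:R : R) => b c kM b0 c0 bc up lnN.
have h1 : c * (2 * (M + 1)) <= c * y by rewrite ler_pM2l.
have h2 : M * b <= M * c by rewrite ler_pM2l.
move: up h1 h2 lnN. by lra.
Qed.

End FactorialGrowth.

Section LaughlinLimit.
Import numFieldNormedType.Exports.
Context {R : realType}.
Variables (p : nat) (theta r : R).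
Hypotheses (p_gt0 : (0 < p)%N) (theta_gt0 : 0 < theta) (r_gt0 : 0 < r).

Lemma cc_limit : (fun N => ln (cc p theta N) / N%:R) @ \oo --> - ln r ->
  exists2 L : R, 0 < L & (fun N => cc p theta N * r ^+ N) @ \oo --> L.
Proof.
move=> rate; pose u N := cc p theta N * r ^+ N.
have cc0 N : 0 < cc p theta N by rewrite (lt_le_trans ltr01)// cc_ge1.
have u_gt0 N : 0 < u N by rewrite /u mulr_gt0// exprn_gt0.
have u0 : u 0%N = 1 by rewrite /u cc_le1// expr0 mulr1.
have u_rate : (fun N => ln (u N) / N%:R) @ \oo --> (0 : R).
  rewrite -(addNr (ln r)).
  have : (fun N => ln (cc p theta N) / N%:R + ln r) @ \oo --> - ln r + ln r.
    by apply: cvgD => //; exact: cvg_cst.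
  apply: cvg_trans; apply: near_eq_cvg; exists 1%N => // N /= N0.
  rewrite /u lnM ?posrE ?exprn_gt0// lnXn// mulrDl -[ln r *+ N]mulr_natr mulfK//.
  by rewrite pnatr_eq0 -lt0n.
pose f n := irr_weight p theta n.+1 * r ^+ n.+1.
have f_ge0 n : 0 <= f n by rewrite /f mulr_ge0 ?irr_weight_ge0// exprn_ge0// ltW.
have uS N : u N.+1 = \sum_(n < N.+1) f n * u (N - n)%N.
  rewrite /u cc_renewal// mulr_suml; apply: eq_bigr => n _.
  have -> : r ^+ N.+1 = r ^+ n.+1 * r ^+ (N - n).
    by rewrite -exprD; congr (_ ^+ _); have := ltn_ord n; lia.
  by rewrite /f; ring.
have f0 : 0 < f 0%N by rewrite /f irr_weight1// mul1r expr1.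
have [K K0 hK] := cc_submul p_gt0 theta_gt0.
have u_ge := submul_ge u_gt0 u0 u_rate (K := K).
have {}u_ge N : K^-1 <= u N.
  apply: u_ge => n m; rewrite /u exprD.
  have -> : K * (cc p theta n * r ^+ n * (cc p theta m * r ^+ m)) =
     K * (cc p theta n * cc p theta m) * (r ^+ n * r ^+ m) by ring.
  by rewrite ler_wpM2r// mulr_ge0// exprn_ge0// ltW.
have u_le1 : forall N, u N <= 1.
  apply: (supermul_le1 u_gt0 u0 u_rate) => n m.
  (* Supermultiplicativity follows from the renewal equation for [n + m]: keep the first renewals up
     to the first index, apply the induction hypothesis after each, and drop the nonnegative
     rest. *)
  elim/ltn_ind: n => -[|n] IH; first by rewrite u0 mul1r.
  rewrite addSn !uS mulr_suml.
  rewrite -[leRHS](big_mkord xpredT (fun i => f i * u (n + m - i)%N)).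
  rewrite (@big_cat_nat _ _ _ n.+1)//=; last by rewrite ltnS leq_addr.
  rewrite -[leLHS](big_mkord xpredT (fun i => f i * u (n - i)%N * u m)).
  rewrite -[leLHS]addr0 lerD//; last first.
    by apply: sumr_ge0 => i _; rewrite mulr_ge0// ltW.
  apply: ler_sum_nat => i /andP[_ hi]; rewrite -mulrA ler_wpM2l//.
  have -> : (n + m - i = (n - i) + m)%N by lia.
  by apply: IH; rewrite ltnS leq_subr.
have Ki : 0 < K^-1 by rewrite invr_gt0.
exact: (renewal_limit u0 uS f_ge0 f0 Ki u_ge u_le1).
Qed.

End LaughlinLimit.

Theorem theorem5p1 (R : realType) (Rc l : R) (p : nat) (r : R) :
  0 < Rc -> 0 < l -> 0 < r ->
  (fun N : nat => ln (fine (CN Rc l p N)) / N%:R) @ \oo --> - ln r ->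
  exists L : R, 0 < L /\
    (fun N : nat => (CN Rc l p N * (r ^+ N)%:E)%E) @ \oo --> L%:E.
Proof.
move=> Rc0 l0 r0.
have t0 : 0 < (l / Rc) ^+ 2 by rewrite exprn_gt0// divr_gt0.
under eq_fun do rewrite CN_cc//=.
(* For [p = 0] the rate hypothesis is contradictory; otherwise the renewal argument applies. *)
case: p => [|p] rate.
  by exfalso; apply: (@fact_rate_diverges R (- ln r)); under eq_fun do rewrite -(cc_p0 ((l / Rc) ^+ 2)).
have [L L0 hL] := cc_limit (ltn0Sn p) t0 r0 rate.
exists L; split=> //; under eq_fun do rewrite CN_cc// -EFinM.
by apply: cvg_EFin; [exact: nearW|exact: hL].
Qed.
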